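(* Let $n\ge2$ and let $\mathbf N=(N_1,\ldots,N_n)$ be a commuting $n$-tuple of bounded operators on a Hilbert space $\mathcal H$. If $\mathbf N$ is a $\mathbf{\Theta}_n$-unitary, then for every $\alpha\in\mathbb T$ the $(n+1)$-tuple $$(\alpha^mI+N_1,\ \alpha^mN_1+N_2,\ \ldots,\ \alpha^mN_{n-2}+N_{n-1},\ \alpha^mN_{n-1}+N_n^p,\ \alpha^{m/p}N_n)$$ is a $\mathbf{\Theta}_{n+1}$-unitary.
   Context: Fix integers $m,p\ge 1$ with $p\mid m$ and put $q=m/p$. $\mathbb T$ is the unit circle in $\mathbb C$ and $\mathbb D$ the open unit disc. For $d\ge1$ and $z=(z_1,\ldots,z_d)\in\mathbb C^d$ let $s_i(z)=\sum_{1\le k_1<\cdots<k_i\le d}z_{k_1}\cdots z_{k_i}$. Define $\theta=(\theta_1,\ldots,\theta_d)$ by $\theta_i(z)=s_i(z_1^m,\ldots,z_d^m)$ for $1\le i\le d-1$ and $\theta_d(z)=(z_1\cdots z_d)^q$; put $\mathbf{\Theta}_d=\theta(\mathbb D^d)$, whose distinguished (Shilov) boundary is $b\mathbf{\Theta}_d=\theta(\mathbb T^d)$. The same $m,p$ are used for $d=n$ and $d=n+1$. A $\mathbf{\Theta}_d$-unitary is a commuting $d$-tuple of bounded normal operators whose joint spectrum is contained in $b\mathbf{\Theta}_d$. For $n=2$ the tuple in the claim is $(\alpha^mI+N_1,\alpha^mN_1+N_2^p,\alpha^{m/p}N_2)$. *)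

(* Defs.v *)
From HB Require Import structures.
From mathcomp Require Import all_boot all_order all_algebra.
From mathcomp Require Import sesquilinear.
From mathcomp Require Import complex.
From mathcomp Require Import boolp classical_sets reals topology normedtype.

Set Implicit Arguments.
Unset Strict Implicit.
Unset Printing Implicit Defensive.

Import Order.TTheory GRing.Theory Num.Theory.
Import numFieldNormedType.Exports.

Local Open Scope classical_set_scope.
Local Open Scope ring_scope.

Section ThetaDomain.
Variables (R : realType) (m p d : nat).
Implicit Types (z : 'I_d -> R[i]).

Definition elem_sym (k : nat) z : R[i] :=
  \sum_(S : {set 'I_d} | #|S| == k) \prod_(j in S) z j.

(* The mathematical index is j.+1; the last coordinate is the one with j.+1 = d. *)
Definition theta z : 'I_d -> R[i] := fun j =>
  if (j.+1 < d)%N then elem_sym j.+1 (fun k => z k ^+ m)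
  else (\prod_k z k) ^+ (m %/ p).

Definition torus : set ('I_d -> R[i]) := [set z | forall k, `|z k| = 1].

Definition bTheta : set ('I_d -> R[i]) := theta @` torus.

End ThetaDomain.

Section Operators.
Variables (R : realType) (H : completeNormedModType R[i]).
Variable dot : {dot H for Num.conj}.

(* A Hilbert space is a complete normed space whose norm comes from dot
   (which is linear in its first argument and conjugate-linear in its second). *)
Definition inner_product_norm : Prop := forall x : H, `|x| ^+ 2 = dot x x.

Definition bounded_operator (T : H -> H) : Prop :=
  linear T /\ exists M : R[i], forall x, `|T x| <= M * `|x|.

Definition is_adjoint (T S : H -> H) : Prop :=
  forall x y, dot (T x) y = dot x (S y).

(* On a Hilbert space a bounded operator has exactly one adjoint (Riesz), so the
   existential only names T^*. *)
Definition normal_operator (T : H -> H) : Prop :=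
  exists2 S, is_adjoint T S & T \o S =1 S \o T.

Definition commuting d (A : 'I_d -> H -> H) : Prop :=
  forall i j, A i \o A j =1 A j \o A i.

(* The Koszul differential w |-> \sum_i e_i /\ A_i w on H (x) Lambda(C^d), where
   w S is the coefficient of e_S, the wedge of the e_i (i in S) in increasing
   order. *)
Definition koszul d (A : 'I_d -> H -> H) (w : {set 'I_d} -> H) : {set 'I_d} -> H :=
  fun S => \sum_(i in S) (-1) ^+ #|[set j in S | (j < i)%N]| *: A i (w (S :\ i)).

(* The differential raises the degree by 1, so kernel = image on the whole exterior
   algebra is exactness of the Koszul complex at every degree. *)
Definition koszul_exact d (A : 'I_d -> H -> H) : Prop :=
  forall w, koszul A w =1 (fun=> 0) -> exists v, w =1 koszul A v.

(* Taylor joint spectrum of a commuting tuple *)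
Definition joint_spectrum d (A : 'I_d -> H -> H) : set ('I_d -> R[i]) :=
  [set lam | ~ koszul_exact (fun i x => A i x - lam i *: x)].

Definition Theta_unitary (m p d : nat) (A : 'I_d -> H -> H) : Prop :=
  [/\ forall i, bounded_operator (A i),
      commuting A,
      forall i, normal_operator (A i)
    & joint_spectrum A `<=` @bTheta R m p d].

(* entry A k is the k-th operator of A counting from 0 (the identity outside the
   range k < d, a value never used below) *)
Definition entry d (A : 'I_d -> H -> H) (k : nat) : H -> H := oapp A id (insub k).

(* For n >= 2:
   (a^m I + N_1, a^m N_1 + N_2, ..., a^m N_{n-2} + N_{n-1},
    a^m N_{n-1} + N_n^p, a^(m/p) N_n) *)
Definition raised_tuple (m p n : nat) (a : R[i]) (N : 'I_n -> H -> H) :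
    'I_n.+1 -> H -> H := fun j x =>
  if j == 0 :> nat then a ^+ m *: x + entry N 0 x
  else if (j < n.-1)%N then a ^+ m *: entry N j.-1 x + entry N j x
  else if j == n.-1 :> nat then a ^+ m *: entry N j.-1 x + iter p (entry N j) x
  else a ^+ (m %/ p) *: entry N j.-1 x.

End Operators.

(* Main.v *)
Require Import Defs.
From HB Require Import structures.
From mathcomp Require Import all_boot all_order all_algebra.
From mathcomp Require Import sesquilinear.
From mathcomp Require Import complex.
From mathcomp Require Import boolp classical_sets reals topology normedtype sequences.
From mathcomp Require Import cyclic separable cyclotomic zify ring lra.

(** With w = theta(z) and z in the n-torus, the displayed tuple evaluated at w is
theta(z, alpha), so it suffices that the joint spectrum of a polynomial image f(N) of a
commuting normal tuple N lies in the image by f of the joint spectrum of N.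

Fuglede's theorem makes all N_i and N_j^* commute. It is proved by Rosenblum's argument
with exp(z A^* ) replaced by (1 + z A^* / k)^k, which makes Liouville's theorem an
average over roots of unity. For commuting normal operators the Koszul complex of F is
exact iff sum_j |F_j x|^2 >= e |x|^2 for some e > 0: coercivity makes sum_j F_j F_j^*
bijective, hence gives a contracting homotopy, and conversely exactness in top degree is
surjectivity of (x_j) |-> sum_j F_j x_j, which gives coercivity by a gliding hump.

So a point of the joint spectrum of f(N) is a joint approximate eigenvalue. It extends to
a joint approximate eigenvalue of f(N) and of the real and imaginary parts of the N_i,
one self-adjoint operator X at a time: the new eigenvalue is
sup_K inf_{|x| = 1} (<X x, x> + K sum_j |Y_j x|^2), where Y is the tuple already
treated. *)

Set Implicit Arguments.
Unset Strict Implicit.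
Unset Printing Implicit Defensive.

Import Order.TTheory GRing.Theory Num.Theory.
Import numFieldNormedType.Exports.

Local Open Scope classical_set_scope.
Local Open Scope ring_scope.

(** * Real-valued norm *)

Section RealNorm.
Variables (R : realType) (H : completeNormedModType R[i]).
Implicit Types (x y : H) (a b : R[i]) (t : R).

Local Notation "t %:C" := (real_complex R t).

(** Norms of [H] take values in [R[i]], whose order is only partial. Real parts move all estimates
    into the ordered field [R]. *)
Definition nm x : R := complex.Re `|x|.
Definition cm a : R := complex.Re `|a|.

Lemma ge0_ReE a : 0 <= a -> a = (complex.Re a)%:C.
Proof. by move=> /ger0_real/RRe_real ->. Qed.

Lemma nmE x : `|x| = (nm x)%:C.
Proof. exact/ge0_ReE/normr_ge0. Qed.

Lemma cmE a : `|a| = (cm a)%:C.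
Proof. exact/ge0_ReE/normr_ge0. Qed.

Lemma nm_ge0 x : 0 <= nm x.
Proof. by rewrite -lecR -nmE normr_ge0. Qed.

Lemma cm_ge0 a : 0 <= cm a.
Proof. by rewrite -lecR -cmE normr_ge0. Qed.

Lemma nm0 : nm 0 = 0.
Proof. by apply: complexI; rewrite -nmE normr0. Qed.

Lemma nm_eq0 x : (nm x == 0) = (x == 0).
Proof. by rewrite -(normr_eq0 x) nmE; apply/eqP/eqP => [->//|/complexI]. Qed.

Lemma nmD x y : nm (x + y) <= nm x + nm y.
Proof. by rewrite -lecR rmorphD/= -!nmE ler_normD. Qed.

Lemma nmZ a x : nm (a *: x) = cm a * nm x.
Proof. by apply: complexI; rewrite rmorphM/= -nmE -cmE -nmE normrZ. Qed.

Lemma nmN x : nm (- x) = nm x.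
Proof. by rewrite /nm normrN. Qed.

Lemma nmB x y : nm (x - y) <= nm x + nm y.
Proof. by rewrite -(nmN y) nmD. Qed.

Lemma nm_distC x y : nm (x - y) = nm (y - x).
Proof. by rewrite -nmN opprB. Qed.

Lemma cmM a b : cm (a * b) = cm a * cm b.
Proof. by apply: complexI; rewrite rmorphM/= -!cmE normrM. Qed.

Lemma cmX a n : cm (a ^+ n) = cm a ^+ n.
Proof. by apply: complexI; rewrite rmorphXn/= -!cmE normrX. Qed.

Lemma cmN a : cm (- a) = cm a.
Proof. by rewrite /cm normrN. Qed.

Lemma cmJ a : cm (Num.conj a) = cm a.
Proof. by rewrite /cm norm_conjC. Qed.

Lemma cm_eq0 a : (cm a == 0) = (a == 0).
Proof. by rewrite -(normr_eq0 a) cmE; apply/eqP/eqP => [->//|/complexI]. Qed.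

Lemma cm_real t : cm t%:C = `|t|.
Proof. by rewrite /cm normc_def/= expr0n/= addr0 sqrtr_sqr. Qed.

Lemma cm1 : cm 1 = 1.
Proof. by rewrite /cm normr1. Qed.

Lemma cmP a t : `|a| = t%:C -> cm a = t.
Proof. by rewrite cmE => /complexI. Qed.

Lemma nm_sum (I : Type) (s : seq I) (P : pred I) (F : I -> H) :
  nm (\sum_(i <- s | P i) F i) <= \sum_(i <- s | P i) nm (F i).
Proof.
elim/big_rec2: _ => [|i u v _ h]; first by rewrite nm0.
by apply: le_trans (nmD _ _) _; rewrite lerD2l.
Qed.

(** Completeness of [H] with an explicit rate, used both for an iterative solution of a linear
    equation and for a gliding hump. *)
Lemma geometric_cvg (y : nat -> H) (C q : R) : 0 <= C -> 0 <= q < 1 ->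
  (forall k, nm (y k.+1 - y k) <= C * q ^+ k) ->
  exists l, forall k, nm (l - y k) <= C * q ^+ k / (1 - q).
Proof.
move=> C0 /andP[q0 q1] hy.
have q1' : 0 < 1 - q by lra.
have dist k n : nm (y (k + n)%N - y k) <= C * q ^+ k / (1 - q).
  (* Subtracting the remaining tail of the geometric series makes the induction on [n] telescope. *)
  suff : nm (y (k + n)%N - y k) <= C * q ^+ k / (1 - q) - C * q ^+ (k + n) / (1 - q).
    move=> /le_trans; apply; rewrite gerBl divr_ge0 ?(ltW q1')// mulr_ge0// exprn_ge0//.
  elim: n => [|n ih]; first by rewrite addn0 !subrr nm0.
  have -> : y (k + n.+1)%N - y k = (y (k + n).+1 - y (k + n)%N) + (y (k + n)%N - y k).
    by rewrite addnS addrA subrK.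
  apply: le_trans (nmD _ _) _.
  have h := hy (k + n)%N.
  have e : C * q ^+ (k + n) / (1 - q) - C * q ^+ (k + n.+1) / (1 - q) = C * q ^+ (k + n).
    by rewrite addnS exprS; field; lra.
  lra.
have q1n : `|q| < 1 by rewrite ger0_norm.
have small e : 0 < e -> exists k, C * q ^+ k / (1 - q) < e.
  move=> e0.
  have : (fun k => C * q ^+ k / (1 - q)) @ \oo --> (C * 0 / (1 - q)).
    by apply: cvgMl; apply: cvgMr; exact: cvg_expr.
  rewrite mulr0 mul0r => /cvgrPdist_lt/(_ _ e0)[k _ /(_ k (leqnn _))]/=.
  rewrite sub0r normrN ger0_norm; first by exists k.
  by rewrite divr_ge0 ?(ltW q1')// mulr_ge0// exprn_ge0.
have cy : cvg (y @ \oo).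
  apply: cauchy_cvg; apply: cauchy_exP => e e0.
  have [k hk] := small (complex.Re e) (ltac:(by rewrite -ltcR -ge0_ReE ?ltW)).
  exists (y k); exists k => // n /= kn.
  rewrite -ball_normE /= nmE nm_distC [ltRHS]ge0_ReE ?ltW// ltcR.
  by apply: le_lt_trans hk; rewrite -(subnKC kn) dist.
exists (lim (y @ \oo)) => k.
apply/ler_addgt0Pr => e e0.
have e0' : 0 < e%:C by rewrite ltcR.
have /cvgrPdist_lt/(_ _ e0')[n _ hn] := cy.
have := hn (n + k)%N (leq_addr _ _); rewrite /= nmE ltcR => h.
have := dist k n; rewrite addnC => h2.
rewrite -(subrK (y (n + k)%N) (lim _)) -addrA.
apply: le_trans (nmD _ _) _; lra.
Qed.

End RealNorm.

(** * Inner product, bounded operators and adjoints *)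

Section InnerProduct.
Variables (R : realType) (H : completeNormedModType R[i]).
Variable dot : {dot H for Num.conj}.
Hypothesis hdot : inner_product_norm dot.
Implicit Types (x y z : H) (a b : R[i]) (t : R) (T S U : H -> H).

Local Notation "t %:C" := (real_complex R t).

Definition rip x y : R := complex.Re (dot x y).

Lemma dotC x y : dot x y = Num.conj (dot y x).
Proof. by rewrite hermC expr0 mul1r. Qed.

Lemma dotDl x y z : dot (x + y) z = dot x z + dot y z.
Proof. exact: linearDl. Qed.

Lemma dotDr x y z : dot z (x + y) = dot z x + dot z y.
Proof. exact: linearDr. Qed.

Lemma dotNl x z : dot (- x) z = - dot x z.
Proof. exact: linearNl. Qed.

Lemma dotNr x z : dot z (- x) = - dot z x.
Proof. exact: linearNr. Qed.

Lemma dotZl a x y : dot (a *: x) y = a * dot x y.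
Proof. by rewrite linearZl_LR. Qed.

Lemma dotZr a x y : dot x (a *: y) = Num.conj a * dot x y.
Proof. by rewrite linearZr_LR. Qed.

Lemma dot_xx x : dot x x = (nm x ^+ 2)%:C.
Proof. by rewrite -hdot nmE rmorphXn. Qed.

Lemma rip_xx x : rip x x = nm x ^+ 2.
Proof. by rewrite /rip dot_xx. Qed.

Lemma rip_sym x y : rip x y = rip y x.
Proof. by rewrite /rip dotC; case: (dot y x). Qed.

Lemma ripDl x y z : rip (x + y) z = rip x z + rip y z.
Proof. by rewrite /rip dotDl; case: (dot x z); case: (dot y z). Qed.

Lemma ripNl x z : rip (- x) z = - rip x z.
Proof. by rewrite /rip dotNl; case: (dot x z). Qed.

Lemma ripZl t x z : rip (t%:C *: x) z = t * rip x z.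
Proof. by rewrite /rip dotZl; case: (dot x z) => u v /=; rewrite mul0r subr0. Qed.

Lemma ripDr x y z : rip z (x + y) = rip z x + rip z y.
Proof. by rewrite rip_sym ripDl !(rip_sym z). Qed.

Lemma ripNr x z : rip z (- x) = - rip z x.
Proof. by rewrite rip_sym ripNl !(rip_sym z). Qed.

Lemma ripZr t x z : rip z (t%:C *: x) = t * rip z x.
Proof. by rewrite rip_sym ripZl !(rip_sym z). Qed.

Lemma rip_sumr (I : Type) (s : seq I) (P : pred I) (F : I -> H) z :
  rip z (\sum_(i <- s | P i) F i) = \sum_(i <- s | P i) rip z (F i).
Proof.
apply: (big_morph (rip z)) => [x y|]; first exact: ripDr.
by rewrite -(scale0r 0) -[0 in LHS]/(0%:C) ripZr mul0r.
Qed.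

(** Cauchy-Schwarz: expand the squared norm of |y| x - |x| y, which equals 2 |x| |y| (|x| |y| - Re
    <x, y>). *)
Lemma rip_le x y : rip x y <= nm x * nm y.
Proof.
have [->|x0] := eqVneq x 0.
  by rewrite nm0 mul0r -(scale0r 0) -[0 in leLHS]/(0%:C) ripZl mul0r.
have [->|y0] := eqVneq y 0.
  by rewrite nm0 mulr0 -(scale0r 0) -[0 in leLHS]/(0%:C) ripZr mul0r.
have nx : 0 < nm x by rewrite lt_neqAle eq_sym nm_eq0 x0 nm_ge0.
have ny : 0 < nm y by rewrite lt_neqAle eq_sym nm_eq0 y0 nm_ge0.
have h := sqr_ge0 (nm ((nm y)%:C *: x - (nm x)%:C *: y)).
rewrite -rip_xx ripDl !ripDr ripNl !ripNr !(ripZl, ripZr) ripNl !ripZl !rip_xx (rip_sym y x) in h.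
have : 0 <= 2 * (nm x * nm y) * (nm x * nm y - rip x y) by lra.
by rewrite pmulr_rge0 ?subr_ge0// mulr_gt0 ?mulr_gt0.
Qed.

Lemma nm_sqrD x y : nm (x + y) ^+ 2 = nm x ^+ 2 + 2 * rip x y + nm y ^+ 2.
Proof. by rewrite -!rip_xx ripDl !ripDr (rip_sym y x); ring. Qed.

Lemma nm_le_rip x (c : R) : 0 <= c -> nm x ^+ 2 <= c * nm x -> nm x <= c.
Proof.
move=> c0; rewrite expr2; have [->//|x0] := eqVneq (nm x) 0.
by rewrite ler_pM2r// lt_neqAle eq_sym x0 nm_ge0.
Qed.

Definition bop T := linear T /\ exists2 M, 0 <= M & forall x, nm (T x) <= M * nm x.

Lemma bopP T : bounded_operator T <-> bop T.
Proof.
split=> -[lT [M]]; last first.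
  move=> M0 h; split=> //; exists M%:C => x.
  by rewrite !nmE -rmorphM/= lecR.
(* A comparison in [R[i]] implies the comparison of real parts. The maximum with 0 covers a negative
   real part, possible only when [H] is zero. *)
move=> h; split=> //; exists (Num.max 0 (complex.Re M)); first by rewrite le_max lexx.
move=> x; have := h x; rewrite !nmE lecE => /andP[_].
have -> : complex.Re (M * (nm x)%:C) = complex.Re M * nm x.
  by case: M {h} => u v /=; rewrite mulr0 subr0.
move=> /le_trans; apply; rewrite ler_wpM2r ?nm_ge0// le_max lexx orbT//.
Qed.

Lemma linD T : linear T -> {morph T : x y / x + y}.
Proof. by move=> l x y; have := l 1 x y; rewrite !scale1r. Qed.

Lemma lin0 T : linear T -> T 0 = 0.
Proof. by move=> l; have := l (-1) 0 0; rewrite !scaleN1r oppr0 addr0 addNr. Qed.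

Lemma linZ T : linear T -> forall a, {morph T : x / a *: x}.
Proof. by move=> l a x; have := l a x 0; rewrite (lin0 l) !addr0. Qed.

Lemma linN T : linear T -> {morph T : x / - x}.
Proof. by move=> l x; rewrite -[in LHS]scaleN1r (linZ l) scaleN1r. Qed.

Lemma linB T : linear T -> {morph T : x y / x - y}.
Proof. by move=> l x y; rewrite (linD l) (linN l). Qed.

Lemma lin_sum T (I : Type) (s : seq I) (P : pred I) (F : I -> H) : linear T ->
  T (\sum_(i <- s | P i) F i) = \sum_(i <- s | P i) T (F i).
Proof. by move=> l; apply: (big_morph T); [exact: linD | exact: lin0]. Qed.

Lemma bop_id : bop id.
Proof. by split=> //; exists 1 => // x; rewrite mul1r. Qed.

Lemma bopD T U : bop T -> bop U -> bop (fun x => T x + U x).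
Proof.
move=> [lT [M M0 hM]] [lU [M' M'0 hM']]; split=> [a x y|].
  by rewrite lT lU scalerDr addrACA.
exists (M + M'); first by rewrite addr_ge0.
by move=> x; rewrite mulrDl; apply: le_trans (nmD _ _) _; rewrite lerD.
Qed.

Lemma bopZ a T : bop T -> bop (fun x => a *: T x).
Proof.
move=> [lT [M M0 hM]]; split=> [b x y|].
  by rewrite lT scalerDr !scalerA mulrC.
exists (cm a * M); first by rewrite mulr_ge0 ?cm_ge0.
by move=> x; rewrite nmZ -mulrA ler_wpM2l ?cm_ge0.
Qed.

Lemma bop_comp T U : bop T -> bop U -> bop (fun x => T (U x)).
Proof.
move=> [lT [M M0 hM]] [lU [M' M'0 hM']]; split=> [a x y|].
  by rewrite lU lT.
exists (M * M'); first by rewrite mulr_ge0.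
by move=> x; apply: le_trans (hM _) _; rewrite -mulrA ler_wpM2l.
Qed.

Lemma adjC T S : is_adjoint dot T S -> is_adjoint dot S T.
Proof. by move=> h x y; rewrite dotC -h -dotC. Qed.

Lemma dot_inj y z : (forall x, dot x y = dot x z) -> y = z.
Proof.
move=> h; apply/eqP; rewrite -subr_eq0 -(nm_eq0 (y - z)) -sqrf_eq0 -rip_xx /rip.
by rewrite dotDr dotNr h subrr.
Qed.

Lemma adj_linear T S : is_adjoint dot T S -> linear S.
Proof.
move=> h a x y; apply: dot_inj => z.
by rewrite -h !dotDr !dotZr !h.
Qed.

(** The same bound serves: |Sx|^2 = <TSx, x> <= M |Sx| |x|. *)
Lemma adj_bop T S : bop T -> is_adjoint dot T S -> bop S.
Proof.
move=> [_ [M M0 hM]] h; split; first exact: adj_linear h.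
exists M => // x; apply: nm_le_rip; first by rewrite mulr_ge0 ?nm_ge0.
rewrite -rip_xx /rip -h; apply: le_trans (rip_le _ _) _.
by rewrite mulrAC ler_wpM2r ?nm_ge0// hM.
Qed.

Lemma normal_nm T S : is_adjoint dot T S -> T \o S =1 S \o T ->
  forall x, nm (S x) = nm (T x).
Proof.
move=> h c x; apply/eqP; rewrite -(eqrXn2 (n := 2))// ?nm_ge0//.
have e : T (S x) = S (T x) := c x.
by rewrite -!rip_xx /rip -h e (adjC h).
Qed.

End InnerProduct.

(** * Fuglede's theorem *)

Section Cauchy.
Variables (R : realType) (H : completeNormedModType R[i]).
Implicit Types (x y : H) (z : R[i]) (T S U : H -> H).

(** X^n - 1 splits and is separable in characteristic 0, so it has n distinct roots, and n distinct
    n-th roots of unity include a primitive one. *)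
Lemma prim_root_ex n : (0 < n)%N -> exists w : R[i], n.-primitive_root w.
Proof.
move=> n0; have [rs ers] := closed_field_poly_normal ('X^n - 1 : {poly R[i]}).
have lc : lead_coef ('X^n - 1 : {poly R[i]}) = 1.
  by apply/monicP; rewrite monicXnsubC.
rewrite lc scale1r in ers.
have nz : (n%:R : R[i]) != 0 by rewrite pnatr_eq0 -lt0n.
have urs : uniq rs.
  by rewrite -separable_prod_XsubC -ers separable_Xn_sub_1.
have hroot w : w \in rs -> n.-unity_root w.
  by move=> wr; rewrite /root_of_unity ers root_prod_XsubC.
have srs : size rs = n.
  by apply/eqP; rewrite -eqSS -(size_prod_XsubC rs id) -ers size_XnsubC.
have /hasP[w _ hw] : has n.-primitive_root rs.
  by apply: has_prim_root => //; [apply/allP | rewrite srs].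
by exists w.
Qed.

Lemma prim_root_sum n (w : R[i]) i : n.-primitive_root w ->
  \sum_(j < n) w ^+ (j * i) = if (n %| i)%N then n%:R else 0.
Proof.
move=> hw; rewrite (prim_order_dvd hw); case: eqP => [e|/eqP e].
  under eq_bigr do rewrite mulnC exprM e expr1n.
  by rewrite sumr_const card_ord.
under eq_bigr do rewrite mulnC exprM.
have := subrX1 (w ^+ i) n; rewrite -exprM mulnC exprM (prim_expr_order hw) expr1n subrr.
by move/esym/eqP; rewrite mulf_eq0 subr_eq0 (negPf e) => /eqP.
Qed.

(* Averaging over the roots of unity isolates the coefficient of degree 1. *)
Lemma cauchy_coef1 n (c : nat -> H) (r C : R) : (1 < n)%N -> 0 < r ->
  (forall z : R[i], cm z = r -> nm (\sum_(i < n) z ^+ i *: c i) <= C) ->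
  r * nm (c 1) <= C.
Proof.
move=> n1 r0 h; have n0 : (0 < n)%N by apply: ltn_trans n1.
have [w hw] := prim_root_ex n0.
have cw : cm w = 1.
  have := @pexprn_eq1 _ (cm w) n (cm_ge0 w).
  by rewrite -cmX (prim_expr_order hw) cm1 eqxx (gtn_eqF n0) => /esym/eqP.
(* The weight w^(j(n-1)) is w^(-j). For i < n the exponent n - 1 + i is a multiple of n only when i
   = 1. *)
have e : \sum_(j < n) w ^+ (j * n.-1) *:
    (\sum_(i < n) ((real_complex R r) * w ^+ j) ^+ i *: c i)
    = n%:R *: ((real_complex R r) *: c 1).
  under eq_bigr do rewrite scaler_sumr.
  rewrite exchange_big /= (bigD1 (Ordinal n1))//= [X in _ + X]big1 ?addr0 => [|i ni].
    transitivity ((\sum_(j < n) w ^+ (j * n)) *: (real_complex R r *: c 1)).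
      rewrite scaler_suml; apply: eq_bigr => j _.
      rewrite expr1 !scalerA; congr (_ *: _).
      by rewrite mulrCA -exprD -mulnSr prednK// mulrC.
    by rewrite (prim_root_sum _ hw) dvdnn.
  transitivity ((\sum_(j < n) w ^+ (j * (n.-1 + i))) *: (real_complex R r ^+ i *: c i)).
    rewrite scaler_suml; apply: eq_bigr => j _.
    rewrite !scalerA; congr (_ *: _).
    by rewrite exprMn mulrCA -exprM -exprD -mulnDr mulrC.
  rewrite (prim_root_sum _ hw).
  case: dvdnP => [[k hk]|_]; last by rewrite scale0r.
  exfalso; move/eqP: ni; apply; apply/val_inj => /=.
  have := ltn_ord i; case: k hk => [|[|k]]; rewrite ?mulSn; lia.
have {e} := congr1 (@nm R H) e.
have -> : nm (n%:R *: (real_complex R r *: c 1)) = n%:R * (r * nm (c 1)).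
  rewrite !nmZ cm_real gtr0_norm//; congr (_ * _).
  by apply: cmP; rewrite normr_nat rmorph_nat.
move=> e; rewrite -(@ler_pM2l _ n%:R) ?ltr0n// -e.
apply: le_trans (nm_sum _ _ _) _.
rewrite mulr_natl -[n in leRHS]card_ord -sumr_const; apply: ler_sum => j _.
rewrite nmZ cmX cw expr1n mul1r; apply: h.
by rewrite cmM cmX cw expr1n mulr1 cm_real gtr0_norm.
Qed.

(** Only the two lowest coefficients are recorded: the one of degree 1 will be a commutator, and the
    one of degree 0 is needed to compute it. *)
Definition poly_fun (P : R[i] -> H) (c0 c1 : H) := exists n (c : nat -> H),
  [/\ (1 < n)%N, c 0 = c0, c 1 = c1 & forall z, P z = \sum_(i < n) z ^+ i *: c i].

Lemma poly_fun_cst x : poly_fun (fun=> x) x 0.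
Proof.
exists 2, (fun i => if i == 0 then x else 0); split=> // z.
by rewrite !big_ord_recl big_ord0 /= expr0 scale1r scaler0 !addr0.
Qed.

Lemma poly_fun_lin P c0 c1 T : linear T -> poly_fun P c0 c1 ->
  poly_fun (fun z => T (P z)) (T c0) (T c1).
Proof.
move=> lT [n [c [n1 <- <- h]]]; exists n, (T \o c); split=> // z.
by rewrite h lin_sum//; apply: eq_bigr => i _; rewrite linZ.
Qed.

Lemma poly_fun_step P c0 c1 T k : linear T -> poly_fun P c0 c1 ->
  poly_fun (fun z => P z + (z * k) *: T (P z)) c0 (c1 + k *: T c0).
Proof.
move=> lT [n [c [n1 <- <- h]]].
exists n.+1, (fun i => (if (i < n)%N then c i else 0) +
   if i is i'.+1 then k *: T (c i') else 0); split.
- by rewrite (ltn_trans n1).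
- by rewrite (ltn_trans _ n1)// addr0.
- by rewrite n1.
move=> z; under [RHS]eq_bigr do rewrite scalerDr.
rewrite big_split/= big_ord_recr/= ltnn scaler0 addr0 h; congr (_ + _).
  by apply: eq_bigr => i _; rewrite ltn_ord.
rewrite big_ord_recl/= scaler0 add0r lin_sum// scaler_sumr.
apply: eq_bigr => i _; rewrite linZ// !scalerA; congr (_ *: _).
by rewrite /bump/= exprS; ring.
Qed.

(** The factor whose k-th iterate, at a = z / k, stands in for exp(z T). *)
Definition id_plus T (a : R[i]) : H -> H := fun x => x + a *: T x.

Lemma poly_fun_iter P c0 c1 T k n : linear T -> poly_fun P c0 c1 ->
  poly_fun (fun z => iter n (id_plus T (z * k)) (P z)) c0 (c1 + (k *+ n) *: T c0).
Proof.
move=> lT h; elim: n => [|n ih]; first by rewrite mulr0n scale0r addr0.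
by rewrite mulrSr scalerDl addrA; exact: poly_fun_step.
Qed.

End Cauchy.

Lemma iter_comm (A : Type) (f g : A -> A) n : (forall x, f (g x) = g (f x)) ->
  forall x, iter n f (g x) = g (iter n f x).
Proof. by move=> h x; elim: n => //= n ->. Qed.

Lemma iter_comp (A : Type) (f g : A -> A) n : (forall x, f (g x) = g (f x)) ->
  forall x, iter n f (iter n g x) = iter n (f \o g) x.
Proof.
move=> h x; by elim: n => //= n <-; rewrite iter_comm.
Qed.

(** A converse of Bernoulli's inequality for small k u: in the inductive step the surplus 2 k u^2 is
    at most u. *)
Lemma bernoulli_le (R : realType) (u : R) k : 0 <= u -> k%:R * u <= 2^-1 ->
  (1 + u) ^+ k <= 1 + 2 * (k%:R * u).
Proof.
move=> u0; elim: k => [|k ih]; first by rewrite expr0 !mul0r mulr0 addr0.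
rewrite -natr1 exprSr => h.
have ku : 0 <= k%:R * u by rewrite mulr_ge0.
have {}ih := ih (ltac:(nra)).
have : (1 + u) ^+ k * (1 + u) <= (1 + 2 * (k%:R * u)) * (1 + u).
  by rewrite ler_wpM2r// addr_ge0.
nra.
Qed.

(** * Approximate exponentials and the commutation theorem *)

Section Fuglede.
Variables (R : realType) (H : completeNormedModType R[i]).
Variable dot : {dot H for Num.conj}.
Hypothesis hdot : inner_product_norm dot.
Implicit Types (x y : H) (a : R[i]) (T S : H -> H).

Lemma iter_nm T (M : R) n : 0 <= M -> (forall x, nm (T x) <= M * nm x) ->
  forall x, nm (iter n T x) <= M ^+ n * nm x.
Proof.
move=> M0 h x; elim: n => [|n ih]; first by rewrite mul1r.
by apply: le_trans (h _) _; rewrite exprS -mulrA ler_wpM2l.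
Qed.

Lemma iter_near_id T (u : R) n : 0 <= u -> (forall x, nm (T x - x) <= u * nm x) ->
  forall x, nm (iter n T x - x) <= ((1 + u) ^+ n - 1) * nm x.
Proof.
move=> u0 h x.
have hT y : nm (T y) <= (1 + u) * nm y.
  by rewrite -[T y](subrK y) addrC mulrDl mul1r; apply: le_trans (nmD _ _) _; rewrite lerD2l.
have u1 : 0 <= 1 + u by rewrite addr_ge0.
elim: n => [|n ih]; first by rewrite subrr nm0 expr0 subrr mul0r.
rewrite iterS -(subrK (iter n T x) (T _)) -addrA.
apply: le_trans (nmD _ _) _.
have := h (iter n T x); have := iter_nm n u1 hT x.
rewrite exprS => h1 h2.
have : u * nm (iter n T x) <= u * ((1 + u) ^+ n * nm x) by rewrite ler_wpM2l.
nra.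
Qed.

Lemma iter_adj T S n : is_adjoint dot T S -> is_adjoint dot (iter n T) (iter n S).
Proof.
move=> h; elim: n => // n ih x y.
by rewrite iterSr ih h -iterS.
Qed.

Lemma id_plus_adj T S a : is_adjoint dot T S ->
  is_adjoint dot (id_plus T a) (id_plus S (Num.conj a)).
Proof. by move=> h x y; rewrite /id_plus dotDl dotDr dotZl dotZr conjCK h. Qed.

Lemma id_plus_lin T a : linear T -> linear (id_plus T a).
Proof.
move=> h b x y; rewrite /id_plus h !scalerDr !scalerA addrACA; congr (_ + _ + _).
by rewrite mulrC.
Qed.

Lemma iter_lin T n : linear T -> linear (iter n T).
Proof. by move=> h b x y; elim: n => //= n ->; rewrite h. Qed.

Lemma id_plus_comm T S a b : linear T -> linear S -> (forall x, T (S x) = S (T x)) ->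
  forall x, id_plus T a (id_plus S b x) = id_plus S b (id_plus T a x).
Proof.
move=> lT lS h x; rewrite /id_plus !(linD lT, linD lS) !(linZ lT, linZ lS) h.
by rewrite !scalerDr !scalerA (mulrC b) -!addrA; congr (_ + _); rewrite addrCA.
Qed.

Lemma iter_id_plus_comm T S a b n : linear T -> linear S ->
  (forall x, T (S x) = S (T x)) ->
  forall x, iter n (id_plus T a) (iter n (id_plus S b) x)
          = iter n (id_plus S b) (iter n (id_plus T a) x).
Proof.
move=> lT lS h x; apply: iter_comm => {}x.
by symmetry; apply: iter_comm => {}x; apply: id_plus_comm.
Qed.

Lemma id_plus_nm T a (M r : R) : (forall x, nm (T x) <= M * nm x) -> cm a <= r ->
  0 <= M -> forall x, nm (id_plus T a x) <= (1 + r * M) * nm x.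
Proof.
move=> h ar M0 x; apply: le_trans (nmD _ _) _; rewrite nmZ mulrDl mul1r lerD2l -mulrA.
by rewrite ler_pM ?cm_ge0 ?nm_ge0.
Qed.

(** (1 + aT)(1 - aT) = 1 - a^2 T^2, so the two factors are inverse up to second order. With a of
    order 1/k, the k-th powers are inverse up to order 1/k. *)
Lemma id_plus_id_plusN T a (M r : R) : linear T -> (forall x, nm (T x) <= M * nm x) ->
  cm a <= r -> 0 <= M ->
  forall x, nm ((id_plus T a \o id_plus T (- a)) x - x) <= (r * M) ^+ 2 * nm x.
Proof.
move=> lT h ar M0 x; rewrite /id_plus/= (linD lT) (linZ lT).
have -> : x + - a *: T x + a *: (T x + - a *: T (T x)) - x = - (a ^+ 2 *: T (T x)).
  rewrite scalerDr scalerA mulrN -expr2 !scaleNr.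
  by rewrite addrA subrK addrAC subrr add0r.
rewrite nmN nmZ cmX exprMn -[leRHS]mulrA.
apply: ler_pM; rewrite ?exprn_ge0 ?cm_ge0 ?nm_ge0//.
  by apply: lerXn2r; rewrite ?nnegrE ?cm_ge0// (le_trans _ ar)// cm_ge0.
by apply: le_trans (h _) _; rewrite expr2 -mulrA ler_wpM2l.
Qed.

Section Normal.
Variables (A A' : H -> H) (M : R).
Hypotheses (lA : linear A) (hadj : is_adjoint dot A A').
Hypothesis hcomm : forall x, A (A' x) = A' (A x).
Hypotheses (M0 : 0 <= M) (hM : forall x, nm (A x) <= M * nm x).
Hypothesis hM' : forall x, nm (A' x) <= M * nm x.

Let lA' : linear A' := adj_linear hdot hadj.

(* The discrete analogue of the unitarity of [exp (z A^* - z^* A)]. *)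
Lemma near_unitary a (r e : R) n : cm a <= r ->
  (1 + (r * M) ^+ 2) ^+ n <= 1 + e ->
  forall x, nm (iter n (id_plus A' a) (iter n (id_plus A (- Num.conj a)) x))
    <= (1 + e) * nm x.
Proof.
move=> ar hn x.
set S := iter n (id_plus A' a); set P' := iter n (id_plus A (- Num.conj a)).
pose P := iter n (id_plus A (Num.conj a)); pose S' := iter n (id_plus A' (- a)).
have e0 : 0 <= 1 + e.
  by apply: le_trans hn; rewrite exprn_ge0// addr_ge0// sqr_ge0.
have aS : is_adjoint dot S P by apply/iter_adj/id_plus_adj/(adjC hadj).
have aP' : is_adjoint dot P' S'.
  rewrite /S' (_ : - a = Num.conj (- Num.conj a)); first exact/iter_adj/id_plus_adj.
  by rewrite rmorphN/= conjCK.
have hSS' y : nm (S (S' y)) <= (1 + e) * nm y.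
  rewrite /S /S' iter_comp; last by move=> ?; apply: id_plus_comm.
  rewrite -[X in nm X](subrK y); apply: le_trans (nmD _ _) _.
  have := iter_near_id n (sqr_ge0 _) (id_plus_id_plusN lA' hM' ar M0) y.
  have := ler_wpM2r (nm_ge0 y) hn; rewrite mulrBl mul1r; lra.
have ar' : cm (Num.conj a) <= r by rewrite cmJ.
have hPP' y : nm (P (P' y)) <= (1 + e) * nm y.
  rewrite /P /P' iter_comp; last by move=> ?; apply: id_plus_comm.
  rewrite -[X in nm X](subrK y); apply: le_trans (nmD _ _) _.
  have := iter_near_id n (sqr_ge0 _) (id_plus_id_plusN lA hM ar' M0) y.
  have := ler_wpM2r (nm_ge0 y) hn; rewrite mulrBl mul1r; lra.
(* Moving both factors across the inner product gives <x, S' P S P' x>. All four commute, so this is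
   <x, (S S')(P P') x>, and each pair has norm at most 1 + e. *)
have : nm (S (P' x)) ^+ 2 <= ((1 + e) * nm x) ^+ 2.
  rewrite -(rip_xx hdot) /rip aS aP'.
  have -> : S' (P (S (P' x))) = S (S' (P (P' x))).
    have PS y : P (S y) = S (P y) by apply: iter_id_plus_comm.
    by rewrite PS; apply: iter_id_plus_comm.
  apply: le_trans (rip_le hdot _ _) _.
  rewrite exprMn !expr2 mulrA [leRHS]mulrC ler_wpM2l ?nm_ge0//.
  by apply: le_trans (hSS' _) _; rewrite -mulrA ler_wpM2l.
by rewrite ler_sqr ?nnegrE ?nm_ge0 ?mulr_ge0 ?nm_ge0.
Qed.

End Normal.

Section Commuting.
Variables (A A' : H -> H) (M : R).
Hypotheses (lA : linear A) (hadj : is_adjoint dot A A').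
Hypothesis hcomm : forall x, A (A' x) = A' (A x).
Hypotheses (M0 : 0 <= M) (hM : forall x, nm (A x) <= M * nm x).
Hypothesis hM' : forall x, nm (A' x) <= M * nm x.

Let lA' : linear A' := adj_linear hdot hadj.

(** Since B commutes with A, the almost trivial product P' P can be inserted around it: S B S' is
    close to (S P') B (P S'), whose outer factors are almost unitary. The error e of the insertion
    is only controlled through the crude bound G on S and S'. *)
Lemma conj_id_plus_bound B (b r e G : R) a n : bop B -> 0 <= b ->
  (forall x, nm (B x) <= b * nm x) -> (forall x, A (B x) = B (A x)) ->
  cm a <= r -> (1 + (r * M) ^+ 2) ^+ n <= 1 + e -> (1 + r * M) ^+ n <= G ->
  forall x, nm (iter n (id_plus A' a) (B (iter n (id_plus A' (- a)) x)))
    <= ((1 + e) ^+ 2 * b + G ^+ 2 * b * e) * nm x.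
Proof.
move=> [lB _] b0 hB cAB ar hn hG x.
set S := iter n (id_plus A' a); set S' := iter n (id_plus A' (- a)).
pose P := iter n (id_plus A (Num.conj a)); pose P' := iter n (id_plus A (- Num.conj a)).
have r0 : 0 <= r by apply: le_trans ar; exact: cm_ge0.
have arc : cm (Num.conj a) <= r by rewrite cmJ.
have arN : cm (- a) <= r by rewrite cmN.
have arcN : cm (- Num.conj a) <= r by rewrite cmN cmJ.
have e0 : 0 <= 1 + e.
  by apply: le_trans hn; rewrite exprn_ge0// addr_ge0// sqr_ge0.
have G0 : 0 <= G by apply: le_trans hG; rewrite exprn_ge0// addr_ge0// mulr_ge0.
have rM0 : 0 <= 1 + r * M by rewrite addr_ge0// mulr_ge0.
have lS : linear S by apply/iter_lin/id_plus_lin.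
have hS y : nm (S y) <= G * nm y.
  apply: le_trans (iter_nm n rM0 (id_plus_nm hM' ar M0) y) _.
  by rewrite ler_wpM2r ?nm_ge0.
have hS' y : nm (S' y) <= G * nm y.
  apply: le_trans (iter_nm n rM0 (id_plus_nm hM' arN M0) y) _.
  by rewrite ler_wpM2r ?nm_ge0.
have P'B y : P' (B y) = B (P' y).
  by apply: iter_comm => z; rewrite /id_plus (linD lB) (linZ lB) cAB.
pose D y := P' (P y) - y.
have hD y : nm (D y) <= e * nm y.
  rewrite /D /P' /P iter_comp; last by move=> ?; apply: id_plus_comm.
  have := iter_near_id n (sqr_ge0 _) (id_plus_id_plusN lA hM arcN M0) y.
  rewrite opprK => /le_trans; apply; rewrite ler_wpM2r ?nm_ge0//; lra.
have e1 : 0 <= e.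
  have : 1 <= (1 + (r * M) ^+ 2) ^+ n by rewrite exprn_ege1// lerDl sqr_ge0.
  lra.
have -> : S (B (S' x)) = S (P' (B (P (S' x)))) - S (B (D (S' x))).
  by rewrite P'B -(linB lS) -(linB lB) /D opprB addrC subrK.
apply: le_trans (nmB _ _) _; rewrite mulrDl; apply: lerD.
  apply: le_trans (near_unitary lA hadj hcomm M0 hM hM' ar hn _) _.
  rewrite expr2 -!mulrA ler_wpM2l//; apply: le_trans (hB _) _.
  rewrite mulrCA ler_wpM2l//.
  have := near_unitary lA' (adjC hadj) (fun y => esym (hcomm y)) M0 hM' hM arc hn.
  by rewrite conjCK; apply.
apply: le_trans (hS _) _; rewrite expr2 -!mulrA ler_wpM2l//.
apply: le_trans (hB _) _; rewrite mulrCA ler_wpM2l//.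
apply: le_trans (hD _) _; rewrite mulrCA ler_wpM2l//; exact: hS'.
Qed.

(** The bound does not depend on r, although k does. With e = G^-2 <= 1, the previous estimate is at
    most 4 b + b. *)
Lemma conj_id_plus_bound_unif B (b r : R) : bop B -> 0 <= b ->
  (forall x, nm (B x) <= b * nm x) -> (forall x, A (B x) = B (A x)) -> 0 < r ->
  exists2 k, (0 < k)%N & forall z x, cm z = r ->
  nm (iter k (id_plus A' (z * k%:R^-1)) (B (iter k (id_plus A' (z * - k%:R^-1)) x)))
    <= 5 * b * nm x.
Proof.
move=> hB b0 hb cAB r0.
(* For k = j L, j factors 1 + r M / k multiply to at most 2, hence all k to at most G = 2^L for
   every j. So G is fixed before j. *)
pose L := (Num.bound (2 * (r * M))).+1; pose G : R := 2 ^+ L.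
have rM0 : 0 <= r * M by rewrite mulr_ge0// ltW.
have hL : 2 * (r * M) <= L%:R.
  have := archi_boundP (mulr_ge0 (ler0n R 2) rM0); rewrite -/(Num.bound _) => h.
  by rewrite ltW// (lt_le_trans h)// ler_nat.
have G1 : 1 <= G by rewrite exprn_ege1// ler1n.
have G0 : 0 < G by apply: lt_le_trans G1.
(* Taking j >= c makes (r M)^2 / k at most G^-2 / 2, which brings the second-order error below e. *)
pose c := 2 * (r * M) ^+ 2 * G ^+ 2.
have c0 : 0 <= c := mulr_ge0 (mulr_ge0 (ler0n R 2) (sqr_ge0 _)) (sqr_ge0 _).
pose j := (Num.bound c).+1.
have hj : c <= j%:R.
  have := archi_boundP c0; rewrite -/(Num.bound _) => h.
  by rewrite ltW// (lt_le_trans h)// ler_nat.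
have k0 : (0 < j * L)%N by [].
have kn0 : (0 : R) < (j * L)%:R by rewrite ltr0n.
have jn0 : (0 : R) < j%:R by rewrite ltr0n.
have Ln0 : (0 : R) < L%:R by rewrite ltr0n.
exists (j * L)%N => // z x zr.
pose e := (G ^+ 2)^-1; pose rk := r / (j * L)%:R.
have G2 : 0 < G ^+ 2 by rewrite exprn_gt0.
have e0 : 0 < e by rewrite invr_gt0.
have e1 : e <= 1 by rewrite invf_le1// exprn_ege1.
have hG : (1 + rk * M) ^+ (j * L) <= G.
  have h : j%:R * (rk * M) = r * M / L%:R.
    by rewrite /rk natrM; field; rewrite !gt_eqF.
  have h2 : r * M / L%:R <= 2^-1 by rewrite ler_pdivrMr//; lra.
  have rk0 : 0 <= rk * M by rewrite mulr_ge0// divr_ge0// ltW.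
  have h3 : (1 + rk * M) ^+ j <= 2.
    by apply: le_trans (bernoulli_le rk0 _) _; rewrite h//; lra.
  by rewrite exprM; apply: lerXn2r; rewrite ?nnegrE// exprn_ge0// addr_ge0.
have hn : (1 + (rk * M) ^+ 2) ^+ (j * L) <= 1 + e.
  have h : (j * L)%:R * (rk * M) ^+ 2 = (r * M) ^+ 2 / (j * L)%:R.
    by rewrite /rk; field; rewrite !gt_eqF.
  have h2 : (r * M) ^+ 2 / (j * L)%:R <= e / 2.
    rewrite ler_pdivrMr// mulrAC ler_pdivlMr//.
    have : e * (j * L)%:R >= e * c.
      rewrite ler_wpM2l ?(ltW e0)// (le_trans hj)// ler_nat leq_pmulr//.
    rewrite /c /e mulrA mulrAC mulVf ?gt_eqF// mul1r; lra.
  apply: le_trans (bernoulli_le (sqr_ge0 _) _) _; rewrite h; lra.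
have zk : cm (z * (j * L)%:R^-1) <= rk.
  rewrite cmM zr ler_wpM2l ?(ltW r0)// /cm normfV normr_nat.
  have -> : ((j * L)%:R : R[i])^-1 = (real_complex R (j * L)%:R^-1).
    by rewrite fmorphV rmorph_nat.
  by [].
rewrite mulrN; apply: le_trans (conj_id_plus_bound hB b0 hb cAB zk hn hG x) _.
rewrite ler_wpM2r ?nm_ge0//.
have -> : G ^+ 2 * b * e = b by rewrite /e mulrAC mulfV ?mul1r// gt_eqF.
have : (1 + e) ^+ 2 <= 2 ^+ 2 by apply: lerXn2r; rewrite ?nnegrE; lra.
move=> /(ler_wpM2r b0); lra.
Qed.

End Commuting.

(** The coefficient of z in (1 + z A'/k)^k B (1 - z A'/k)^k x is A' B x - B A' x. By the averaging
    estimate, r times its norm [d] is at most 5 b |x| for every r > 0, which forces d = 0. *)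
Theorem fuglede A A' B : bop A -> is_adjoint dot A A' ->
  (forall x, A (A' x) = A' (A x)) -> bop B -> (forall x, A (B x) = B (A x)) ->
  forall x, A' (B x) = B (A' x).
Proof.
move=> [lA [M M0 hM]] hadj hcomm hB cAB x.
have hM' y : nm (A' y) <= M * nm y by rewrite (normal_nm hdot hadj hcomm).
have lA' := adj_linear hdot hadj.
have [lB [b b0 hb]] := hB.
apply/eqP; rewrite -subr_eq0 -nm_eq0.
set d := nm _; have d0 : 0 <= d := nm_ge0 _.
suff h r : 0 < r -> r * d <= 5 * b * nm x.
  have : 0 <= 5 * b * nm x by rewrite !mulr_ge0 ?nm_ge0.
  set K := _ * nm x => K0.
  apply/eqP/le_anti; rewrite d0 andbT leNgt; apply/negP => d1.
  have := h ((K + 1) / d) (divr_gt0 (ltr_wpDl K0 ltr01) d1).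
  by rewrite divfK ?gt_eqF// -/K; lra.
move=> r0.
have [k k0 hk] := conj_id_plus_bound_unif lA hadj hcomm M0 hM hM' hB b0 hb cAB r0.
have := poly_fun_iter (k%:R^-1) k lA'
  (poly_fun_lin lB (poly_fun_iter (- k%:R^-1) k lA' (poly_fun_cst x))).
have k1 : (k%:R^-1 : R[i]) *+ k = 1.
  by rewrite -[LHS]mulr_natr mulVf// pnatr_eq0 -lt0n.
rewrite add0r mulNrn k1 scaleN1r scale1r (linN lB).
move=> [n [c [n1 c0 c1 hc]]].
rewrite /d addrC -c1; apply: cauchy_coef1 n1 r0 _ => z zr.
by rewrite -hc; apply: hk.
Qed.

End Fuglede.

(** * Joint approximate eigenvalues *)

Section JointEigenvalue.
Variables (R : realType) (H : completeNormedModType R[i]).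
Variable dot : {dot H for Num.conj}.
Hypothesis hdot : inner_product_norm dot.
Implicit Types (x y v : H) (K t : R).

Local Notation "t %:C" := (real_complex R t).

Definition sqnorm (I : finType) (Y : I -> H -> H) x : R := \sum_i nm (Y i x) ^+ 2.

(** Zero is a joint approximate eigenvalue of [Y]. *)
Definition approx_kernel (I : finType) (Y : I -> H -> H) :=
  forall e : R, 0 < e -> exists2 x, nm x = 1 & sqnorm Y x <= e.

Lemma sqnorm_ge0 (I : finType) (Y : I -> H -> H) x : 0 <= sqnorm Y x.
Proof. by apply: sumr_ge0 => i _; exact: sqr_ge0. Qed.

Lemma sqnorm_bound (I : finType) (Y : I -> H -> H) : (forall i, bop (Y i)) ->
  exists2 b, 0 <= b & forall x, sqnorm Y x <= b * nm x ^+ 2.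
Proof.
move=> hY; have /choice[b hb] i : exists b, 0 <= b /\ forall x, nm (Y i x) <= b * nm x.
  by have [_ [b b0 h]] := hY i; exists b.
exists (\sum_i b i ^+ 2); first by apply: sumr_ge0 => i _; exact: sqr_ge0.
move=> x; rewrite mulr_suml; apply: ler_sum => i _; have [b0 h] := hb i.
rewrite -exprMn; apply: lerXn2r => //; first by rewrite nnegrE nm_ge0.
by rewrite nnegrE mulr_ge0 ?nm_ge0.
Qed.

Section Step.
Variables (I : finType) (Y : I -> H -> H) (X : H -> H) (c b : R).
Hypotheses (lY : forall i, linear (Y i)) (lX : linear X).
Hypotheses (saX : is_adjoint dot X X) (YX : forall i x, Y i (X x) = X (Y i x)).
Hypotheses (c0 : 0 <= c) (hX : forall x, nm (X x) <= c * nm x).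
Hypotheses (b0 : 0 <= b) (hq : forall x, sqnorm Y x <= b * nm x ^+ 2).
Hypothesis kerY : approx_kernel Y.

Local Notation q := (sqnorm Y).

(** The quadratic form of X + K sum_i Y_i^* Y_i. The penalty K drives near-minimisers towards the
    approximate kernel of [Y], and [m K] is the lower bound of the form on the unit sphere. *)
Let val K x := rip dot (X x) x + K * q x.
Let vals K := [set val K x | x in [set x | nm x = 1]].
Let m K := inf (vals K).

Let ripX x : rip dot (X x) x <= c * nm x ^+ 2.
Proof.
by apply: le_trans (rip_le hdot _ _) _; rewrite expr2 mulrA ler_wpM2r ?nm_ge0.
Qed.

Let ripX' x : - (c * nm x ^+ 2) <= rip dot (X x) x.
Proof.
rewrite lerNl -ripNl; apply: le_trans (rip_le hdot _ _) _.
by rewrite nmN expr2 mulrA ler_wpM2r ?nm_ge0.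
Qed.

Let lb_vals K : 0 <= K -> lbound (vals K) (- c).
Proof.
move=> K0 _ [x /= x1 <-]; have := ripX' x; rewrite x1 expr1n mulr1 => h.
by have := mulr_ge0 K0 (sqnorm_ge0 Y x); rewrite /val; lra.
Qed.

Let has_inf_vals K : 0 <= K -> has_inf (vals K).
Proof.
move=> K0; split; last by exists (- c); exact: lb_vals.
by have [x x1 _] := kerY (ltr01); exists (val K x), x.
Qed.

Let m_le K x : 0 <= K -> nm x = 1 -> m K <= val K x.
Proof.
move=> K0 x1; apply: ge_inf; last by exists x.
by exists (- c); exact: lb_vals.
Qed.

Let m_ge K : 0 <= K -> - c <= m K.
Proof.
move=> K0; apply: lb_le_inf; last exact: lb_vals.
by have [] := has_inf_vals K0.
Qed.

Let m_adherent K (e : R) : 0 <= K -> 0 < e -> exists2 x, nm x = 1 & val K x < m K + e.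
Proof.
move=> K0 e0; have [_ [x /= x1 <-] h] := inf_adherent e0 (has_inf_vals K0).
by exists x.
Qed.

(** On unit vectors nearly killed by [Y] the penalty is negligible, so the bound is uniform in K and
    the supremum over K is finite. *)
Let m_lec K : 0 <= K -> m K <= c.
Proof.
move=> K0; apply/ler_addgt0Pr => e e0.
have K1 : 0 < K + 1 by lra.
have [x x1 hx] := kerY (divr_gt0 e0 K1).
apply: le_trans (m_le K0 x1) _; rewrite /val.
have := ripX x; rewrite x1 expr1n mulr1 => h1.
have : K * q x <= e.
  apply: le_trans (_ : (K + 1) * q x <= _); last by rewrite mulrC -ler_pdivlMr.
  by rewrite ler_wpM2r ?sqnorm_ge0//; lra.
lra.
Qed.

Let m_hom K x : 0 <= K -> m K * nm x ^+ 2 <= val K x.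
Proof.
move=> K0; have [->|x0] := eqVneq x 0.
  rewrite nm0 expr0n/= mulr0 /val (lin0 lX) -rip_sym//.
  have := mulr_ge0 K0 (sqnorm_ge0 Y 0); have := ripX' 0.
  by rewrite (lin0 lX) nm0 expr0n/= mulr0 oppr0; lra.
have nx : 0 < nm x by rewrite lt_neqAle eq_sym nm_eq0 x0 nm_ge0.
pose u := (nm x)^-1%:C *: x.
have u1 : nm u = 1 by rewrite nmZ cm_real gtr0_norm ?invr_gt0// mulVf// gt_eqF.
have -> : x = (nm x)%:C *: u.
  by rewrite scalerA -rmorphM/= mulfV ?gt_eqF// scale1r.
have e : val K ((nm x)%:C *: u) = nm x ^+ 2 * val K u.
  rewrite /val (linZ lX) ripZl ripZr// /sqnorm mulrDr expr2 !mulrA; congr (_ + _).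
  rewrite [_ * K]mulrC -!mulrA; congr (_ * _); rewrite !mulr_sumr; apply: eq_bigr => i _.
  by rewrite (linZ (lY i)) nmZ cm_real gtr0_norm// exprMn expr2 mulrA.
rewrite e nmZ u1 mulr1 cm_real gtr0_norm// mulrC ler_wpM2l ?sqr_ge0//.
exact: m_le.
Qed.

Let val_sub K x v t : val K (x - t%:C *: v) =
  val K x - 2 * t * (rip dot (X x) v + K * \sum_i rip dot (Y i x) (Y i v)) + t ^+ 2 * val K v.
Proof.
have hY i : nm (Y i (x - t%:C *: v)) ^+ 2 =
    nm (Y i x) ^+ 2 - 2 * t * rip dot (Y i x) (Y i v) + t ^+ 2 * nm (Y i v) ^+ 2.
  rewrite (linB (lY i)) (linZ (lY i)) (nm_sqrD hdot) ripNr// ripZr// nmN nmZ cm_real.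
  by rewrite exprMn real_normK ?num_real//; ring.
have hq' : q (x - t%:C *: v) =
    q x - 2 * t * \sum_i rip dot (Y i x) (Y i v) + t ^+ 2 * q v.
  rewrite /sqnorm (eq_bigr _ (fun i _ => hY i)) big_split/= big_split/= sumrN.
  by rewrite !mulr_sumr.
rewrite /val hq' (linB lX) (linZ lX) !(ripDl, ripDr, ripNl, ripNr, ripZl, ripZr)//.
have -> : rip dot (X v) x = rip dot (X x) v by rewrite /rip saX -/(rip dot v (X x)) rip_sym.
ring.
Qed.

(** A near-minimiser x for K is nearly critical: the form [val K] minus m K |x|^2 is nonnegative and
    almost 0 at x, so its first variation along v = (X - m K) x is small, and this bounds |v|^2. *)
Let step_estimate (d : R) : 0 < d <= 1 -> exists2 x, nm x = 1 &
  q x <= 2 * d /\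
  nm (X x - (sup [set m K | K in [set K | 1 <= K]])%:C *: x) ^+ 2 <= (16 * c + 10) * d.
Proof.
move=> /andP[d0 d1]; set E := [set m K | K in _]; set s := sup E.
have hE : has_sup E.
  split; first by exists (m 1), 1 => /=.
  by exists c => _ [K /= K1 <-]; apply: m_lec; lra.
have [_ [K0 /= K1 <-] hK0] := sup_adherent d0 hE.
(* Doubling [K0] leaves the term K0 q(x) as a surplus: it is at most m K + t d - m K0, hence at most
   2 d because both infima are close to or below s. *)
have [K defK] : exists K, K = 2 * K0 by exists (2 * K0).
have KE : 1 <= K by lra.
have Kge0 : 0 <= K by lra.
have ms : m K <= s by apply: sup_upper_bound => //; exists K.
rewrite -/s in hK0; clearbody s; clear hE E.
(* [W] bounds the coefficient of t^2 in the variation below, and t is chosen with t W <= d. The 1 in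
   its denominator covers W = 0. *)
pose W := (2 * c + K * b) * (2 * c) ^+ 2.
have cKb : 0 <= 2 * c + K * b by rewrite addr_ge0// mulr_ge0.
have W0 : 0 <= W := mulr_ge0 cKb (sqr_ge0 _).
pose t := d / (W + 1).
have t0 : 0 < t by rewrite divr_gt0//; lra.
have tW : t * W <= d.
  by rewrite /t mulrAC ler_pdivrMr; [rewrite ler_wpM2l//; lra | lra].
have [x x1 hx] := m_adherent Kge0 (mulr_gt0 t0 d0 : 0 < t * d).
have td : t * d <= d.
  rewrite ler_piMl ?(ltW d0)// /t ler_pdivrMr; lra.
have hm0 : m K0 <= val K0 x by apply: m_le => //; lra.
have qx0 := sqnorm_ge0 Y x.
have vK : val K x = val K0 x + K0 * q x by rewrite /val defK; ring.
have hKq : K0 * q x <= 2 * d by lra.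
have hq2 : q x <= 2 * d by apply: le_trans hKq; rewrite ler_peMl.
have smK : s - m K <= 2 * d.
  have := mulr_ge0 (le_trans ler01 K1) qx0; lra.
exists x => //; split=> //.
pose V y := X y - (m K)%:C *: y.
pose v := V x.
have mKc := m_lec Kge0; have mKc' := m_ge Kge0.
have absm : `|m K| <= c by rewrite ler_norml mKc' mKc.
have hV y : nm (V y) <= 2 * c * nm y.
  apply: le_trans (nmB _ _) _; rewrite nmZ cm_real.
  by have := hX y; have := ler_wpM2r (nm_ge0 y) absm; lra.
have nv : nm v <= 2 * c by have := hV x; rewrite x1 mulr1.
have nv0 := nm_ge0 v.
have YV i : Y i v = V (Y i x) by rewrite /v /V (linB (lY i)) (linZ (lY i)) YX.
(* Each Y_i commutes with V = X - m K, so the cross terms are <Y_i x, V Y_i x>, with |V| <= 2 c.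
   Multiplied by K = 2 K0 they cost at most 8 c d. *)
have hYV : - (2 * c * q x) <= \sum_i rip dot (Y i x) (Y i v).
  rewrite /sqnorm mulr_sumr -sumrN; apply: ler_sum => i _.
  rewrite YV lerNl -ripNl; apply: le_trans (rip_le hdot _ _) _.
  rewrite nmN mulrC expr2 mulrA ler_wpM2r ?nm_ge0//.
have beta : rip dot (X x) v = nm v ^+ 2 + m K * rip dot x v.
  by rewrite -(rip_xx hdot) /v /V ripDl ripNl ripZl; ring.
have valv : val K v - m K * nm v ^+ 2 <= W.
  have := ripX v; have := hq v; have h1 : nm v ^+ 2 <= (2 * c) ^+ 2.
    by apply: lerXn2r => //; rewrite nnegrE// mulr_ge0.
  have := ler_wpM2l Kge0 (hq v).
  have : (2 * c + K * b) * nm v ^+ 2 <= W.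
    by rewrite /W ler_wpM2l.
  have := ler_wpM2r (sqr_ge0 (nm v)) absm; have := ler_norm (- m K).
  rewrite normrN /val => h2 h3.
  have := ler_wpM2r (sqr_ge0 (nm v)) h2; lra.
(* Nonnegativity of the shifted form at x - t v: one t d comes from the near-minimality of x, the
   other from t^2 W. *)
have key : 2 * t * (nm v ^+ 2 + K * \sum_i rip dot (Y i x) (Y i v)) <= t * d + t * d.
  have := m_hom (x - t%:C *: v) Kge0; rewrite val_sub beta.
  rewrite (nm_sqrD hdot) x1 nmN nmZ cm_real (gtr0_norm t0) ripNr ripZr//.
  have := ler_wpM2l (sqr_ge0 t) valv.
  have := ler_wpM2l (ltW t0) tW.
  lra.
have {}key : nm v ^+ 2 <= 8 * c * d + d.
  have := ler_wpM2l Kge0 hYV.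
  have : 2 * (nm v ^+ 2 + K * \sum_i rip dot (Y i x) (Y i v)) <= 2 * d.
    rewrite -(ler_pM2l t0); lra.
  have := ler_wpM2l c0 hKq; rewrite defK; lra.
(* The squared norm is at most 2 |v|^2 + 2 (s - m K)^2 <= 2 (8 c + 1) d + 8 d^2, hence the constant
   16 c + 10. *)
have -> : X x - s%:C *: x = v - (s - m K)%:C *: x.
  by rewrite /v /V rmorphB/= scalerBl opprB addrA subrK.
have h := nmB v ((s - m K)%:C *: x).
have sm0 : 0 <= s - m K by lra.
rewrite nmZ x1 mulr1 cm_real ger0_norm// in h.
have : nm (v - (s - m K)%:C *: x) ^+ 2 <= (nm v + (s - m K)) ^+ 2.
  by apply: lerXn2r; rewrite ?nnegrE ?nm_ge0// addr_ge0.
have := sqr_ge0 (nm v - (s - m K)).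
have : (s - m K) ^+ 2 <= (2 * d) ^+ 2 by apply: lerXn2r; rewrite ?nnegrE// mulr_ge0// ltW.
have : d ^+ 2 <= d by rewrite expr2 ler_piMr// ltW.
move: (s - m K) => u; rewrite !exprMn; lra.
Qed.

Lemma approx_kernel_step : exists s : R, forall e : R, 0 < e ->
  exists2 x, nm x = 1 & q x <= e /\ nm (X x - s%:C *: x) ^+ 2 <= e.
Proof.
exists (sup [set m K | K in [set K | 1 <= K]]) => e e0.
have k0 : 0 < 16 * c + 10 by have := c0; lra.
pose d := Num.min 1 (e / (16 * c + 10)).
have d0 : 0 < d by rewrite lt_min ltr01 divr_gt0.
have d1 : d <= 1 by rewrite ge_min lexx.
have de : (16 * c + 10) * d <= e by rewrite mulrC -ler_pdivlMr// ge_min lexx orbT.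
have [|x x1 [h1 h2]] := @step_estimate d; first by rewrite d0.
exists x => //; split; last exact: le_trans de.
by have := c0; have := mulr_ge0 c0 (ltW d0); lra.
Qed.

End Step.

(** Induction on l: X_0 - s joins the tuple [Y], whose index type therefore has to vary. *)
Lemma approx_kernel_joint l (I : finType) (Y : I -> H -> H) (X : 'I_l -> H -> H) :
  (forall i, bop (Y i)) -> (forall j, bop (X j)) ->
  (forall j, is_adjoint dot (X j) (X j)) ->
  (forall i j x, Y i (X j x) = X j (Y i x)) ->
  (forall j k x, X k (X j x) = X j (X k x)) -> approx_kernel Y ->
  exists s : 'I_l -> R, forall e : R, 0 < e -> exists2 x, nm x = 1 &
    sqnorm Y x <= e /\ forall j, nm (X j x - (s j)%:C *: x) ^+ 2 <= e.
Proof.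
elim: l I Y X => [|l ih] I Y X bY bX saX YX XX kerY; last first.
  have [lX [c c0 hc]] := bX ord0; have [b b0 hb] := sqnorm_bound bY.
  have [s hs] := approx_kernel_step (fun i => (bY i).1) lX (saX ord0)
    (fun i x => YX i ord0 x) c0 hc b0 hb kerY.
  pose Z (i : I + unit) : H -> H :=
    if i is inl i' then Y i' else fun x => X ord0 x + - s%:C *: x.
  have sqZ x : sqnorm Z x = sqnorm Y x + nm (X ord0 x - s%:C *: x) ^+ 2.
    by rewrite /sqnorm big_sumType/=; congr (_ + _); rewrite (big_pred1 tt)?scaleNr// => -[].
  have [||||||s' hs'] := ih _ Z (fun j => X (lift ord0 j)).
  - move=> [i|_] /=; first exact: bY.
    by apply: bopD => //; apply: bopZ; exact: bop_id.
  - by move=> j; exact: bX.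
  - by move=> j; exact: saX.
  - move=> [i|u] j x; first exact: YX.
    by have [lXj _] := bX (lift ord0 j); rewrite /= (linD lXj) (linZ lXj) XX.
  - by move=> j k x; exact: XX.
  - move=> e e0; have e2 : 0 < e / 2 by lra.
    have [x x1 [h1 h2]] := hs _ e2; exists x => //; rewrite sqZ; lra.
  exists (fun j => if unlift ord0 j is Some j' then s' j' else s) => e /hs'[x x1 []].
  rewrite sqZ => h1 h2; have h3 := sqnorm_ge0 Y x.
  have h4 := sqr_ge0 (nm (X ord0 x - s%:C *: x)).
  exists x => //; split; first by lra.
  move=> j; case: unliftP => [j' ->|->]; first exact: h2.
  lra.
exists (fun=> 0) => e /kerY[x x1 hx]; by exists x => //; split=> // -[].
Qed.

End JointEigenvalue.

(** * The Koszul complex *)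

Section KoszulHomotopy.
Variables (R : realType) (H : completeNormedModType R[i]) (d : nat).
Implicit Types (F G A : 'I_d -> H -> H) (S T : {set 'I_d}) (w : {set 'I_d} -> H).

Definition koszul_sign (i : 'I_d) S : R[i] := (-1) ^+ #|[set j in S | (j < i)%N]|.

(** Interior multiplication by the tuple [G]. When the G_i are the adjoints of the F_i, it is the
    formal adjoint of [koszul F]. *)
Definition koszul_contraction G w S : H :=
  \sum_(i in ~: S) koszul_sign i S *: G i (w (i |: S)).

Lemma koszul_sign_setU1 (i k : 'I_d) S : k \notin S ->
  koszul_sign i (k |: S) = (-1) ^+ (k < i)%N * koszul_sign i S.
Proof.
move=> kS; rewrite /koszul_sign -exprD; congr (_ ^+ _).
have [ki|ki] := boolP (k < i)%N.
  have -> : [set j in k |: S | (j < i)%N] = k |: [set j in S | (j < i)%N].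
    by apply/finset.setP => j; rewrite !inE; case: eqP => [->|]; rewrite ?ki.
  by rewrite cardsU1 !inE (negPf kS).
congr #|pred_of_set _|; apply/finset.setP => j; rewrite !inE.
by case: eqP => [->|//]; rewrite (negPf ki) !andbF.
Qed.

Lemma koszul_sign_sqr i S : koszul_sign i S * koszul_sign i S = 1.
Proof. by rewrite -expr2 sqrr_sign. Qed.

(** The anticommutation of e_i /\ with contraction by e_k: exactly one of k < i and i < k holds,
    which produces the sign. *)
Lemma koszul_sign_swap (i k : 'I_d) S : i \in S -> k \notin S ->
  koszul_sign i S * koszul_sign k (S :\ i)
  = - (koszul_sign k S * koszul_sign i (k |: S)).
Proof.
move=> iS kS; rewrite koszul_sign_setU1// -[in RHS](finset.setD1K iS).
rewrite [koszul_sign k (i |: _)]koszul_sign_setU1 ?finset.setD11// (finset.setD1K iS).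
have ik : (i != k :> nat)%N by apply: contraNneq kS => /val_inj <-.
case: ltngtP ik => // _ _; rewrite ?expr0 ?expr1; ring.
Qed.

(** The diagonal terms with i in S come from the first composite and those with i outside S from the
    second. The mixed terms cancel by the sign rule, as the F_i commute with the G_k. *)
Lemma koszul_homotopy F G w S : (forall i, linear (F i)) -> (forall i, linear (G i)) ->
  (forall i k x, F i (G k x) = G k (F i x)) ->
  koszul F (koszul_contraction G w) S + koszul_contraction G (koszul F w) S
  = \sum_i F i (G i (w S)).
Proof.
move=> lF lG FG.
pose X i k := (koszul_sign i S * koszul_sign k (S :\ i)) *: F i (G k (w (k |: (S :\ i)))).
have -> : koszul F (koszul_contraction G w) S =
    \sum_(i in S) F i (G i (w S)) + \sum_(i in S) \sum_(k in ~: S) X i k.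
  rewrite -big_split; apply: eq_bigr => i iS /=.
  rewrite /koszul_contraction (bigD1 i) ?inE ?eqxx//= (linD (lF i)) scalerDr; congr (_ + _).
    rewrite (linZ (lF i)) scalerA -/(koszul_sign i S) finset.setD1K//.
    have -> : koszul_sign i (S :\ i) = koszul_sign i S.
      by rewrite -[in RHS](finset.setD1K iS) koszul_sign_setU1 ?finset.setD11// ltnn mul1r.
    by rewrite koszul_sign_sqr scale1r.
  rewrite (lin_sum _ _ _ (lF i)) scaler_sumr; apply: eq_big => [k|k _].
    by rewrite !inE; case: eqVneq => [->|]; rewrite ?iS// andbT.
  by rewrite (linZ (lF i)) scalerA.
have -> : koszul_contraction G (koszul F w) S =
    \sum_(k in ~: S) F k (G k (w S)) - \sum_(k in ~: S) \sum_(i in S) X i k.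
  rewrite -sumrN -big_split; apply: eq_bigr => k; rewrite inE => kS /=.
  rewrite /koszul (bigD1 k) ?inE ?eqxx//= (linD (lG k)) scalerDr; congr (_ + _).
    rewrite (linZ (lG k)) scalerA -/(koszul_sign k (k |: S)) finset.setU1K//.
    by rewrite koszul_sign_setU1// ltnn mul1r koszul_sign_sqr scale1r FG.
  rewrite (lin_sum _ _ _ (lG k)) scaler_sumr -sumrN; apply: eq_big => [i|i].
    by rewrite !inE; case: eqVneq => [->|]; rewrite ?(negPf kS)// andbT.
  rewrite !inE => /andP[/orP[->//|iS] ik]; rewrite (linZ (lG k)) scalerA -scaleNr.
  rewrite -/(koszul_sign i (k |: S)) koszul_sign_swap// opprK FG.
  congr (_ *: G k (F i (w _))); apply/finset.setP => j; rewrite !inE.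
  by case: (eqVneq j i) => [->|]; rewrite ?(negPf ik)//= andbT.
rewrite [X in _ + (_ - X)]exchange_big/= addrACA subrr addr0.
rewrite [RHS](bigID (mem S))/=; congr (_ + _).
by apply: eq_bigl => i; rewrite inE.
Qed.

(** A form concentrated in top degree is a cycle, because S :\ i is never the full set when i is in
    S. The top coefficient of a primitive gives the x_i up to sign. *)
Lemma koszul_exact_surj A : (forall i, linear (A i)) -> koszul_exact A ->
  forall y, exists x, y = \sum_i A i (x i).
Proof.
move=> lA ex y; pose w S : H := if S == finset.setT then y else 0.
have [|v hv] := ex w.
  move=> S; apply: big1 => i iS; rewrite /w.
  case: eqP => [e|_]; last by rewrite (lin0 (lA i)) scaler0.
  by have := finset.in_setT i; rewrite -e !inE eqxx.
exists (fun i => koszul_sign i finset.setT *: v (finset.setT :\ i)).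
have := hv finset.setT; rewrite /w eqxx => ->; apply: eq_big => [i|i _]; first by rewrite inE.
by rewrite (linZ (lA i)).
Qed.

End KoszulHomotopy.

(** * Koszul exactness and coercivity *)

Section KoszulSpectrum.
Variables (R : realType) (H : completeNormedModType R[i]).
Variable dot : {dot H for Num.conj}.
Hypothesis hdot : inner_product_norm dot.
Implicit Types (x y : H).

Local Notation "t %:C" := (real_complex R t).

Lemma le0_geometric (a C q : R) : 0 <= q < 1 -> (forall k, a <= C * q ^+ k) -> a <= 0.
Proof.
move=> /andP[q0 q1] h; have q1n : `|q| < 1 by rewrite ger0_norm.
have hc : (fun k => C * q ^+ k) @ \oo --> C * 0 by apply: cvgMr; exact: cvg_expr.
rewrite mulr0 in hc; rewrite leNgt; apply/negP => a0.
move/cvgrPdist_lt/(_ _ a0) : hc => [k _ /(_ k (leqnn _))]/=.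
rewrite sub0r normrN => /(le_lt_trans (ler_norm _)).
by rewrite ltNge h.
Qed.

Lemma sqnormZ (I : finType) (Y : I -> H -> H) (t : R[i]) x :
  (forall i, linear (Y i)) -> sqnorm Y (t *: x) = cm t ^+ 2 * sqnorm Y x.
Proof.
move=> lY; rewrite /sqnorm mulr_sumr; apply: eq_bigr => i _.
by rewrite (linZ (lY i)) nmZ exprMn.
Qed.

Lemma approx_kernelN (I : finType) (Y : I -> H -> H) : (forall i, linear (Y i)) ->
  ~ approx_kernel Y ->
  exists2 e, 0 < e & forall x, e * nm x ^+ 2 <= sqnorm Y x.
Proof.
move=> lY; apply: contra_notP => hn e e0.
apply: contrapT => ne; apply: hn; exists e => // x.
have [->|x0] := eqVneq x 0; first by rewrite nm0 expr0n/= mulr0 sqnorm_ge0.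
have nx : 0 < nm x by rewrite lt_neqAle eq_sym nm_eq0 x0 nm_ge0.
rewrite leNgt; apply/negP => hx; apply: ne; exists ((nm x)^-1%:C *: x).
  by rewrite nmZ cm_real gtr0_norm ?invr_gt0// mulVf// gt_eqF.
rewrite sqnormZ// cm_real gtr0_norm ?invr_gt0// exprVn mulrC.
by rewrite ler_pdivrMr ?exprn_gt0// ltW.
Qed.

Section Coercive.
Variables (d : nat) (F F' : 'I_d -> H -> H).
Hypotheses (bF : forall i, bop (F i)) (aF : forall i, is_adjoint dot (F i) (F' i)).
Hypotheses (FF : forall i j x, F i (F j x) = F j (F i x)).
Hypotheses (FF' : forall i j x, F i (F' j x) = F' j (F i x)).
Variable e : R.
Hypotheses (e0 : 0 < e) (he : forall x, e * nm x ^+ 2 <= sqnorm F x).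

(** Since F_i and F_i^* commute, <Q x, x> is the sum of the |F_i x|^2, so the lower bound on
    [sqnorm] makes [Q] strictly positive. *)
Let Q x := \sum_i F i (F' i x).

Let bF' i : bop (F' i) := adj_bop hdot (bF i) (aF i).

Let bQ : bop Q.
Proof.
split=> [a x y|].
  rewrite /Q scaler_sumr -big_split; apply: eq_bigr => i _ /=.
  by rewrite (bF' i).1 (bF i).1.
have /choice[b hb] i : exists b, 0 <= b /\ forall x, nm (F i (F' i x)) <= b * nm x.
  by have [_ [b b0 h]] := bop_comp (bF i) (bF' i); exists b.
exists (\sum_i b i) => [|x]; first by apply: sumr_ge0 => i _; have [] := hb i.
apply: le_trans (nm_sum _ _ _) _; rewrite mulr_suml; apply: ler_sum => i _.
by have [_ h] := hb i.
Qed.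

Let ripQ x : rip dot (Q x) x = sqnorm F x.
Proof.
rewrite rip_sym rip_sumr//; apply: eq_bigr => i _.
by rewrite FF' /rip -aF -(rip_xx hdot).
Qed.

Let Q_inj x : Q x = 0 -> x = 0.
Proof.
move=> Qx; apply/eqP; rewrite -nm_eq0 -sqrf_eq0; apply/eqP/le_anti.
rewrite sqr_ge0 andbT -(ler_pM2l e0) mulr0; apply: le_trans (he x) _.
by rewrite -ripQ Qx -(scale0r 0) -[0 in leLHS]/(0%:C) ripZl mul0r.
Qed.

(** The iteration x - t (Q x - y) converges: |u - t Q u|^2 <= (1 - 2 t e + t^2 b^2) |u|^2 <= (1 - t
    e / 2)^2 |u|^2 once t b^2 <= e. *)
Let Q_surj y : exists x, Q x = y.
Proof.
have [lQ [b b0 hb]] := bQ.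
have be : 0 < b ^+ 2 + e ^+ 2 by rewrite ltr_wpDl ?sqr_ge0// exprn_gt0.
have [t [t0 te tb]] : exists t, [/\ 0 < t, t * e <= 1 & t * b ^+ 2 <= e].
  exists (e / (b ^+ 2 + e ^+ 2)); split; first by rewrite divr_gt0.
    by rewrite mulrAC ler_pdivrMr// mul1r -expr2 lerDr sqr_ge0.
  by rewrite mulrAC ler_pdivrMr// ler_wpM2l ?(ltW e0)// lerDl sqr_ge0.
pose q := 1 - t * e / 2.
have te0 : 0 < t * e by rewrite mulr_gt0.
have q0 : 0 <= q by rewrite /q; lra.
have q1 : q < 1 by rewrite /q; lra.
have contr u : nm (u - t%:C *: Q u) <= q * nm u.
  rewrite -ler_sqr ?nnegrE ?nm_ge0 ?mulr_ge0 ?nm_ge0// (nm_sqrD hdot) nmN nmZ.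
  rewrite cm_real (gtr0_norm t0) ripNr ripZr// rip_sym ripQ !exprMn.
  have h1 := ler_wpM2l (ltW t0) (he u).
  have h2 : t ^+ 2 * nm (Q u) ^+ 2 <= t * e * nm u ^+ 2.
    rewrite [t ^+ 2]expr2 -!mulrA ler_wpM2l ?(ltW t0)//.
    apply: (@le_trans _ _ (t * (b ^+ 2 * nm u ^+ 2))).
      rewrite ler_wpM2l ?(ltW t0)// -exprMn; apply: lerXn2r; rewrite ?nnegrE ?nm_ge0//.
      by rewrite mulr_ge0 ?nm_ge0.
    by rewrite mulrA ler_wpM2r ?sqr_ge0.
  have h3 : 0 <= (t * e / 2) ^+ 2 * nm u ^+ 2 by rewrite -exprMn sqr_ge0.
  rewrite /q; lra.
pose x_ k := iter k (fun x => x - t%:C *: (Q x - y)) 0.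
have res k : nm (Q (x_ k) - y) <= nm y * q ^+ k.
  elim: k => [|k ih]; first by rewrite /= (lin0 lQ) sub0r nmN expr0 mulr1.
  have -> : Q (x_ k.+1) - y = (Q (x_ k) - y) - t%:C *: Q (Q (x_ k) - y).
    by rewrite [x_ k.+1]/= (linB lQ) (linZ lQ) addrAC.
  apply: le_trans (contr _) _; rewrite exprS mulrCA ler_wpM2l//.
have [|||l hl] := @geometric_cvg _ _ x_ (t * nm y) q.
- by rewrite mulr_ge0 ?nm_ge0// ltW.
- by rewrite q0.
- move=> k; rewrite [x_ k.+1]/= addrAC subrr sub0r nmN nmZ cm_real gtr0_norm//.
  by rewrite -mulrA ler_wpM2l// ltW.
exists l; apply/eqP; rewrite -subr_eq0 -nm_eq0 eq_le nm_ge0 andbT.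
apply: (@le0_geometric _ (b * (t * nm y) / (1 - q) + nm y) q); first by rewrite q0.
move=> k; have -> : Q l - y = Q (l - x_ k) + (Q (x_ k) - y).
  by rewrite (linB lQ) addrA subrK.
apply: le_trans (nmD _ _) _; rewrite mulrDl; apply: lerD; last exact: res.
apply: le_trans (hb _) _; apply: le_trans (ler_wpM2l b0 (hl k)) _.
by rewrite le_eqVlt; apply/orP; left; apply/eqP; ring.
Qed.

(** Write w = Q u coefficientwise. [Q] commutes with the differential and is injective, so u is a
    cycle as well, and the homotopy formula shows w to be the differential of the contraction of
    u. *)
Lemma coercive_koszul_exact : koszul_exact F.
Proof.
move=> w hw; have /choice[u hu] : forall S, exists x, Q x = w S by move=> S; exact: Q_surj.
have lF i : linear (F i) := (bF i).1.
have lF' i : linear (F' i) := (bF' i).1.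
have hom S : koszul F (koszul_contraction F' u) S + koszul_contraction F' (koszul F u) S
    = Q (u S) by exact: koszul_homotopy.
have du S : koszul F u S = 0.
  apply: Q_inj; rewrite -[RHS](hw S) /koszul (lin_sum _ _ _ bQ.1).
  apply: eq_bigr => i _; rewrite (linZ bQ.1); congr (_ *: _).
  rewrite -hu /Q (lin_sum _ _ _ (lF i)); apply: eq_bigr => j _.
  by rewrite -FF' FF.
exists (koszul_contraction F' u) => S.
rewrite -hu -hom [X in _ + X]big1 ?addr0// => i _.
by rewrite du (lin0 (lF' i)) scaler0.
Qed.

End Coercive.

(** Gliding hump: unit vectors v_k with |A'_i v_k| <= 32^-k, and l = sum_k +-8^-k v_k. If l = sum_i
    A_i x_i, then |Re <l, v_k>| <= C 32^-k, while the signs keep it at least (6/7) 8^-k. *)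
Lemma koszul_exact_approx_kernelN d (A A' : 'I_d -> H -> H) :
  (forall i, linear (A i)) -> (forall i, is_adjoint dot (A i) (A' i)) ->
  (forall i x, nm (A' i x) = nm (A i x)) ->
  koszul_exact A -> ~ approx_kernel A.
Proof.
move=> lA aA nA ex ker.
pose eta k : R := (32^-1) ^+ k.
have eta0 k : 0 < eta k by rewrite exprn_gt0// invr_gt0.
have /choice[v hv] k : exists x, nm x = 1 /\ sqnorm A x <= eta k ^+ 2.
  by have [x x1 hx] := ker _ (exprn_gt0 2 (eta0 k)); exists x.
have hvA k i : nm (A' i (v k)) <= eta k.
  rewrite nA -ler_sqr ?nnegrE ?nm_ge0 ?(ltW (eta0 k))//; have [_ h] := hv k; apply: le_trans h.
  by rewrite /sqnorm (bigD1 i)//= lerDl sumr_ge0// => j _; exact: sqr_ge0.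
pose a k : R := (8^-1) ^+ k.
have a0 k : 0 < a k by rewrite exprn_gt0// invr_gt0.
(* With this sign the new term cannot cancel against the partial sum in the direction v_k. *)
pose sg (y u : H) : R := if 0 <= rip dot y u then 1 else -1.
pose y_ := fix y_ k := if k is k'.+1 then
  y_ k' + (sg (y_ k') (v k') * a k')%:C *: v k' else 0 : H.
have ysucc k : y_ k.+1 = y_ k + (sg (y_ k) (v k) * a k)%:C *: v k by [].
have hy k : nm (y_ k.+1 - y_ k) <= 1 * (8^-1) ^+ k.
  rewrite ysucc addrAC subrr add0r nmZ cm_real normrM (gtr0_norm (a0 k)).
  rewrite (hv k).1 mulr1 /sg; case: ifP; rewrite ?normrN normr1//.
have yr k : a k <= `|rip dot (y_ k.+1) (v k)|.
  rewrite ysucc ripDl ripZl rip_xx// (hv k).1 expr1n mulr1 /sg.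
  have := a0 k; case: ifPn; rewrite -?ltNge => h ak.
    rewrite ger0_norm; lra.
  rewrite ltr0_norm; lra.
have [|l hl] := geometric_cvg ler01 _ hy.
  by rewrite invr_ge0 ler0n/= invf_lt1// ltr1n.
have [x hx] := koszul_exact_surj lA ex l.
pose C := \sum_i nm (x i).
have up k : `|rip dot l (v k)| <= C * eta k.
  have hxv (u : H) : nm u = nm (v k) -> (forall i, nm (A' i u) <= eta k) ->
      rip dot l u <= C * eta k.
    move=> _ hu; rewrite hx rip_sym rip_sumr// mulr_suml; apply: ler_sum => i _.
    rewrite rip_sym /rip aA; apply: le_trans (rip_le hdot _ _) _.
    by rewrite ler_wpM2l ?nm_ge0.
  have lA' i := adj_linear hdot (aA i).
  rewrite ler_norml lerNl -ripNr; apply/andP; split; apply: hxv => //.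
    by rewrite nmN.
  by move=> i; rewrite (linN (lA' i)) nmN.
(* The terms after index k have total norm at most 8^-k / 7. *)
have low k : 6 / 7 * a k <= `|rip dot l (v k)|.
  have e : rip dot l (v k) = rip dot (y_ k.+1) (v k) + rip dot (l - y_ k.+1) (v k).
    by rewrite [rip dot (l - _) _]ripDl ripNl addrC subrK.
  have h1 := rip_le hdot (l - y_ k.+1) (v k).
  have h2 := rip_le hdot (- (l - y_ k.+1)) (v k).
  have := hl k.+1; rewrite nmN (hv k).1 mulr1 ripNl in h1 h2 *.
  rewrite mul1r exprS -/(a k) => h3.
  have h4 : 8^-1 * a k / (1 - 8^-1) = 7^-1 * a k by field.
  have h5 : `|rip dot (l - y_ k.+1) (v k)| <= 7^-1 * a k by rewrite ler_norml; lra.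
  have := ler_normB (rip dot l (v k)) (rip dot (l - y_ k.+1) (v k)).
  rewrite {1}e addrK; have := yr k; lra.
suff : (6 / 7 : R) <= 0 by lra.
apply: (@le0_geometric _ C 4^-1) => [|k].
  by rewrite invr_ge0 ler0n/= invf_lt1// ltr1n.
rewrite -(ler_pM2r (a0 k)) -[leRHS]mulrA; apply: le_trans (low k) _.
apply: le_trans (up k) _.
have -> // : eta k = 4^-1 ^+ k * a k.
by rewrite /eta /a -exprMn; congr (_ ^+ _); field.
Qed.

End KoszulSpectrum.

(** * Spectral mapping *)

Section SpectralMapping.
Variables (R : realType) (H : completeNormedModType R[i]).
Variable dot : {dot H for Num.conj}.
Hypothesis hdot : inner_product_norm dot.
Variables (n : nat) (N N' : 'I_n -> H -> H).
Hypotheses (bN : forall i, bop (N i)) (aN : forall i, is_adjoint dot (N i) (N' i)).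
Hypothesis NN : forall i j x, N i (N j x) = N j (N i x).
Hypothesis NN'_diag : forall i x, N i (N' i x) = N' i (N i x).
Implicit Types (x : H) (T U S : H -> H) (w : 'I_n -> R[i]) (f g : ('I_n -> R[i]) -> R[i]).

Local Notation "t %:C" := (real_complex R t).

(* [symbol_of T f]: [T] is a polynomial in the [N i] and [N' i], and [f] is the same
   polynomial in the coordinates and their conjugates. *)
Inductive symbol_of : (H -> H) -> (('I_n -> R[i]) -> R[i]) -> Prop :=
| symbol_gen i : symbol_of (N i) (fun w => w i)
| symbol_adj i : symbol_of (N' i) (fun w => Num.conj (w i))
| symbol_id : symbol_of id (fun=> 1)
| symbol_add T U f g : symbol_of T f -> symbol_of U g ->
    symbol_of (fun x => T x + U x) (fun w => f w + g w)
| symbol_scale a T f : symbol_of T f ->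
    symbol_of (fun x => a *: T x) (fun w => a * f w)
| symbol_comp T U f g : symbol_of T f -> symbol_of U g ->
    symbol_of (fun x => T (U x)) (fun w => f w * g w).

Let bN' i : bop (N' i) := adj_bop hdot (bN i) (aN i).

Let NN' i j x : N' i (N j x) = N j (N' i x).
Proof. exact: (fuglede hdot (bN i) (aN i) (NN'_diag i) (bN j) (NN i j)). Qed.

Let N'N' i j x : N' i (N' j x) = N' j (N' i x).
Proof.
apply: (fuglede hdot (bN i) (aN i) (NN'_diag i) (bN' j)) => {}x.
by rewrite NN'.
Qed.

Lemma symbol_bop T f : symbol_of T f -> bop T.
Proof.
elim=> *; [exact: bN | exact: bN' | exact: bop_id | exact: bopD | exact: bopZ |].
exact: bop_comp.
Qed.

Lemma symbol_comm T U f g : symbol_of T f -> symbol_of U g ->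
  forall x, T (U x) = U (T x).
Proof.
(* An operator commuting with all generators commutes with every polynomial in them. It is applied
   first with S a generator, then with S = T. *)
have commI S S1 : (forall i x, S (N i x) = N i (S x)) ->
    (forall i x, S (N' i x) = N' i (S x)) -> linear S ->
    forall h, symbol_of S1 h -> forall x, S (S1 x) = S1 (S x).
  move=> h1 h2 lS h; elim=> //.
  - by move=> T1 U1 f1 g1 _ ih1 _ ih2 x; rewrite (linD lS) ih1 ih2.
  - by move=> a T1 f1 _ ih1 x; rewrite (linZ lS) ih1.
  - by move=> T1 U1 f1 g1 _ ih1 _ ih2 x; rewrite ih1 ih2.
move=> hT hU; apply: (commI T U _ _ (symbol_bop hT).1 _ hU) => i x; symmetry.
  by apply: (commI (N i) T _ _ (bN i).1 _ hT).
by apply: (commI (N' i) T _ _ (bN' i).1 _ hT).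
Qed.

Lemma symbol_adjoint T f : symbol_of T f ->
  exists S, symbol_of S (fun w => Num.conj (f w)) /\ is_adjoint dot T S.
Proof.
elim.
- by move=> i; exists (N' i); split; [exact: symbol_adj | exact: aN].
- move=> i; exists (N i); split; last exact/adjC/aN.
  rewrite (_ : (fun w => _) = fun w => w i); first exact: symbol_gen.
  by apply/funext => w; rewrite conjCK.
- exists id; split=> //; rewrite (_ : (fun w => _) = fun=> 1); first exact: symbol_id.
  by apply/funext => w; rewrite rmorph1.
- move=> T1 U1 f1 g1 _ [S1 [hS1 aS1]] _ [S2 [hS2 aS2]].
  exists (fun x => S1 x + S2 x); split; last first.
    by move=> x y; rewrite dotDl dotDr aS1 aS2.
  rewrite (_ : (fun w => _) = fun w => Num.conj (f1 w) + Num.conj (g1 w)).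
    exact: symbol_add.
  by apply/funext => w; rewrite rmorphD.
- move=> a T1 f1 _ [S1 [hS1 aS1]].
  exists (fun x => Num.conj a *: S1 x); split; last first.
    by move=> x y; rewrite dotZl dotZr conjCK aS1.
  rewrite (_ : (fun w => _) = fun w => Num.conj a * Num.conj (f1 w)).
    exact: symbol_scale.
  by apply/funext => w; rewrite rmorphM.
- move=> T1 U1 f1 g1 _ [S1 [hS1 aS1]] _ [S2 [hS2 aS2]].
  exists (fun x => S2 (S1 x)); split; last first.
    by move=> x y; rewrite aS1 aS2.
  rewrite (_ : (fun w => _) = fun w => Num.conj (g1 w) * Num.conj (f1 w)).
    exact: symbol_comp.
  by apply/funext => w; rewrite rmorphM mulrC.
Qed.

Let res w x := \sum_i nm (N i x - w i *: x).

Let res_ge i w x : nm (N i x - w i *: x) <= res w x.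
Proof. by rewrite /res (bigD1 i)//= lerDl sumr_ge0// => j _; exact: nm_ge0. Qed.

Let normal_shift i a x : nm (N' i x - Num.conj a *: x) = nm (N i x - a *: x).
Proof.
have aNa : is_adjoint dot (fun x => N i x - a *: x) (fun x => N' i x - Num.conj a *: x).
  by move=> u v; rewrite dotDl dotDr dotNl dotNr dotZl dotZr conjCK aN.
apply: (normal_nm hdot aNa) => u /=.
rewrite (linB (bN i).1) (linB (bN' i).1) (linZ (bN i).1) (linZ (bN' i).1) NN'.
rewrite !scalerBr !scalerA mulrC !opprB -!addrA; congr (_ + _).
by rewrite addrCA [RHS]addrCA; congr (_ + _); exact: addrC.
Qed.

(** T - f(w) lies in the ideal generated by the N_i - w_i and their adjoints, and normality gives
    both the same norm on each vector. The constant may depend on w but not on x. *)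
Lemma symbol_approx T f w : symbol_of T f ->
  exists2 C : R, 0 <= C & forall x, nm (T x - f w *: x) <= C * res w x.
Proof.
have res0 x : 0 <= res w x by apply: sumr_ge0 => i _; exact: nm_ge0.
elim.
- by move=> i; exists 1 => // x; rewrite mul1r; exact: res_ge.
- by move=> i; exists 1 => // x; rewrite mul1r normal_shift; exact: res_ge.
- by exists 0 => // x; rewrite scale1r subrr nm0 mul0r.
- move=> T1 U1 f1 g1 _ [C1 C10 h1] _ [C2 C20 h2].
  exists (C1 + C2) => [|x]; first exact: addr_ge0.
  rewrite scalerDl opprD addrACA mulrDl; apply: le_trans (nmD _ _) _.
  exact: lerD.
- move=> a T1 f1 _ [C1 C10 h1]; exists (cm a * C1) => [|x].
    by rewrite mulr_ge0 ?cm_ge0.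
  by rewrite -scalerA -scalerBr nmZ -mulrA ler_wpM2l ?cm_ge0.
- move=> T1 U1 f1 g1 hT [C1 C10 h1] _ [C2 C20 h2].
  have [lT [M M0 hM]] := symbol_bop hT.
  exists (M * C2 + cm (g1 w) * C1) => [|x].
    by rewrite addr_ge0// mulr_ge0// cm_ge0.
  have -> : T1 (U1 x) - (f1 w * g1 w) *: x =
      T1 (U1 x - g1 w *: x) + g1 w *: (T1 x - f1 w *: x).
    rewrite (linB lT) (linZ lT) scalerBr scalerA mulrC addrA subrK//.
  apply: le_trans (nmD _ _) _; rewrite mulrDl; apply: lerD.
    by apply: le_trans (hM _) _; rewrite -mulrA ler_wpM2l.
  by rewrite nmZ -mulrA ler_wpM2l ?cm_ge0.
Qed.

(** The real parts of the N_i, followed by their imaginary parts (N_i - N_i^* ) / 2i, written in the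
    shape of the constructors of [symbol_of]. *)
Let SA (j : 'I_(n + n)) : H -> H := match fintype.split j with
  | inl i => fun x => 2^-1 *: (N i x + N' i x)
  | inr i => fun x => (2^-1 * - 'i) *: (N i x + - 1 *: N' i x)
  end.

Let SA_symbol j : exists f, symbol_of (SA j) f.
Proof.
rewrite /SA; case: fintype.split => i; eexists; apply: symbol_scale; apply: symbol_add.
- exact: symbol_gen.
- exact: symbol_adj.
- exact: symbol_gen.
- apply: symbol_scale; exact: symbol_adj.
Qed.

Let SA_selfadj j : is_adjoint dot (SA j) (SA j).
Proof.
have c2 : Num.conj (2^-1 : R[i]) = 2^-1 by apply/conj_Creal/ger0_real; rewrite invr_ge0 ler0n.
rewrite /SA; case: fintype.split => i x y; rewrite !dotZl !dotZr !dotDl !dotDr.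
  by rewrite c2 aN (adjC (aN i)) addrC.
rewrite rmorphM/= c2 rmorphN/= conjCi opprK dotZl dotZr rmorphN rmorph1 aN (adjC (aN i)).
ring.
Qed.

Let SA_split i s t x :
  N i x - (s%:C + 'i * t%:C) *: x = (SA (lshift n i) x - s%:C *: x) +
    'i *: (SA (rshift n i) x - t%:C *: x).
Proof.
rewrite /SA (unsplitK (inl i)) (unsplitK (inr i)).
rewrite [in RHS]scalerBr addrACA -opprD !scalerA -scalerDl; congr (_ - _).
have -> : 'i * (2^-1 * - 'i) = 2^-1 :> R[i].
  by rewrite mulrCA mulrN -expr2 sqrCi opprK mulr1.
rewrite -scalerDr scaleN1r addrACA subrr addr0.
rewrite -[N i x in X in _ *: X]scale1r -scalerDl scalerA mulVf ?scale1r//.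
by rewrite pnatr_eq0.
Qed.

Theorem joint_spectrum_symbol d (F : 'I_d -> H -> H) (f : 'I_d -> ('I_n -> R[i]) -> R[i])
    (lam : 'I_d -> R[i]) : (forall j, symbol_of (F j) (f j)) ->
  joint_spectrum F lam ->
  exists2 w, joint_spectrum N w & forall j, lam j = f j w.
Proof.
move=> hF hlam.
pose G j x := F j x + (- lam j) *: x.
have hG j : symbol_of (G j) (fun w => f j w + - lam j * 1).
  by apply: symbol_add => //; apply: symbol_scale; exact: symbol_id.
have {}hlam : ~ koszul_exact G.
  rewrite (_ : G = fun i x => F i x - lam i *: x)//.
  by apply/funext => i; apply/funext => x; rewrite /G scaleNr.
have /choice[G' hG'] j : exists S, (exists g, symbol_of S g) /\ is_adjoint dot (G j) S.
  by have [S [hS aS]] := symbol_adjoint (hG j); exists S; split=> //; eexists; exact: hS.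
(* Without approximate kernel the tuple would be coercive, hence its Koszul complex exact. *)
have kerG : approx_kernel G.
  apply: contrapT => /(approx_kernelN (fun j => (symbol_bop (hG j)).1))[e e0 he].
  apply: hlam; apply: (coercive_koszul_exact hdot _ (fun j => (hG' j).2) _ _ e0 he).
  - by move=> j; exact: symbol_bop (hG j).
  - by move=> i j x; exact: symbol_comm (hG i) (hG j) x.
  - by move=> i j x; have [[g hg] _] := hG' j; exact: symbol_comm (hG i) hg x.
have [||||||s hs] := approx_kernel_joint (l := n + n) hdot (Y := G) (X := SA).
- by move=> j; exact: symbol_bop (hG j).
- by move=> j; have [g hg] := SA_symbol j; exact: symbol_bop hg.
- exact: SA_selfadj.
- by move=> i j x; have [g hg] := SA_symbol j; exact: symbol_comm (hG i) hg x.
- move=> j k x; have [g hg] := SA_symbol j; have [g' hg'] := SA_symbol k.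
  exact: symbol_comm hg' hg x.
- exact: kerG.
pose w i := (s (lshift n i))%:C + 'i * (s (rshift n i))%:C.
have key e : 0 < e -> exists2 x, nm x = 1 &
    (forall j, nm (F j x - lam j *: x) <= e) /\ forall i, nm (N i x - w i *: x) <= 2 * e.
  move=> e0; have [x x1 [hGx hX]] := hs _ (exprn_gt0 2 e0); exists x => //; split.
    move=> j; rewrite -ler_sqr ?nnegrE ?nm_ge0 ?(ltW e0)//; apply: le_trans hGx.
    rewrite -scaleNr -/(G j x) /sqnorm (bigD1 j)//= lerDl.
    by apply: sumr_ge0 => k _; exact: sqr_ge0.
  have hX' j : nm (SA j x - (s j)%:C *: x) <= e.
    by rewrite -ler_sqr ?nnegrE ?nm_ge0 ?(ltW e0).
  move=> i; rewrite SA_split; apply: le_trans (nmD _ _) _; rewrite nmZ.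
  have -> : cm ('i : R[i]) = 1 by apply: cmP; rewrite normCi.
  by have := hX' (lshift n i); have := hX' (rshift n i); lra.
exists w.
  (* The vectors from [key] are approximately killed by all N_i - w_i, which exactness forbids. *)
  rewrite /joint_spectrum/= => ex.
  have lNw i : linear (fun x => N i x - w i *: x).
    move=> a x y; rewrite (bN i).1 scalerDr opprD addrACA scalerBr; congr (_ + _ + _).
    by rewrite !scalerA mulrC.
  apply: (koszul_exact_approx_kernelN hdot lNw _ _ ex
     (A' := fun i x => N' i x - Num.conj (w i) *: x)).
  - by move=> i u v; rewrite dotDl dotDr dotNl dotNr dotZl dotZr conjCK aN.
  - by move=> i x; exact: normal_shift.
  move=> e e0; have n0 : 0 < n%:R * 4 + 1 :> R by rewrite ltr_wpDl// mulr_ge0.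
  pose e' := Num.min 1 (e / (n%:R * 4 + 1)).
  have e'0 : 0 < e' by rewrite lt_min ltr01 divr_gt0.
  have e'1 : e' <= 1 by rewrite ge_min lexx.
  have e'e : (n%:R * 4 + 1) * e' <= e by rewrite mulrC -ler_pdivlMr// ge_min lexx orbT.
  have [x x1 [_ hx]] := key _ e'0; exists x => //.
  apply: le_trans (_ : \sum_(i < n) 4 * e' <= _); last first.
    by rewrite sumr_const card_ord -mulr_natl; lra.
  apply: ler_sum => i _; apply: (@le_trans _ _ ((2 * e') ^+ 2)).
    by apply: lerXn2r; rewrite ?nnegrE ?nm_ge0// mulr_ge0// ltW.
  by rewrite exprMn -natrX ler_wpM2l// expr2 ler_piMr// ltW.
(* On the same unit vectors F_j acts approximately both as lam_j and as f_j(w), so the two scalars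
   agree. *)
move=> j; apply/eqP; rewrite -subr_eq0 -cm_eq0 eq_le cm_ge0 andbT.
have [C C0 hC] := symbol_approx w (hF j).
have K0 : 0 < C * n%:R * 2 + 1 by rewrite ltr_wpDl// !mulr_ge0.
apply/ler_addgt0Pr => e e0; rewrite add0r.
have [x x1 [h1 h2]] := key _ (divr_gt0 e0 K0).
rewrite -[cm _]mulr1 -x1 -nmZ.
have -> : (lam j - f j w) *: x = (F j x - f j w *: x) - (F j x - lam j *: x).
  by rewrite scalerBl opprB [RHS]addrC addrA subrK.
apply: le_trans (nmB _ _) _.
have -> : e = C * (n%:R * (2 * (e / (C * n%:R * 2 + 1)))) + e / (C * n%:R * 2 + 1).
  by field; rewrite gt_eqF.
apply: lerD (h1 j); apply: le_trans (hC x) _; rewrite ler_wpM2l//.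
apply: le_trans (ler_sum _ (fun i _ => h2 i)) _.
by rewrite sumr_const card_ord -[leLHS]mulr_natl.
Qed.

End SpectralMapping.

(** * The map theta *)

Section ElementarySymmetric.
Variable R : realType.
Implicit Types (a : R[i]).

(** Generating polynomial; appending a coordinate to z then multiplies it by one linear factor. *)
Lemma elem_symE d (z : 'I_d -> R[i]) k :
  elem_sym k z = (\prod_i (z i *: 'X + 1) : {poly R[i]})`_k.
Proof.
rewrite bigA_distr coef_sum /elem_sym big_mkcond; apply: eq_bigr => /= S _.
have -> : \prod_i (if i \in S then z i *: 'X else 1) =
    (\prod_(j in S) z j) *: 'X^#|S| :> {poly R[i]}.
  by rewrite -big_mkcond scaler_prod prodr_const.
by rewrite coefZ coefXn eq_sym; case: eqP; rewrite ?mulr1 ?mulr0.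
Qed.

(** The default a is reached exactly at the last index, where [insub] fails. *)
Definition snoc_fun d (z : 'I_d -> R[i]) a : 'I_d.+1 -> R[i] :=
  fun k => oapp z a (insub (k : nat)).

Lemma snoc_fun_widen d (z : 'I_d -> R[i]) a i : snoc_fun z a (widen_ord (leqnSn d) i) = z i.
Proof. by rewrite /snoc_fun /= valK. Qed.

Lemma snoc_fun_max d (z : 'I_d -> R[i]) a : snoc_fun z a ord_max = a.
Proof. by rewrite /snoc_fun insubF//= ltnn. Qed.

Lemma elem_sym_snoc d (z : 'I_d -> R[i]) a k m :
  elem_sym k.+1 (fun i => snoc_fun z a i ^+ m)
  = elem_sym k.+1 (fun i => z i ^+ m) + a ^+ m * elem_sym k (fun i => z i ^+ m).
Proof.
rewrite !elem_symE big_ord_recr/= snoc_fun_max.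
under eq_bigr do rewrite snoc_fun_widen.
by rewrite mulrDr mulr1 coefD -scalerAr coefZ coefMX/= addrC.
Qed.

Lemma elem_sym0 d (z : 'I_d -> R[i]) : elem_sym 0 z = 1.
Proof.
rewrite elem_symE -horner_coef0 horner_prod big1// => i _.
by rewrite hornerD hornerZ hornerX mulr0 add0r hornerC.
Qed.

Lemma elem_sym_max d (z : 'I_d -> R[i]) : elem_sym d z = \prod_i z i.
Proof.
rewrite /elem_sym (big_pred1 finset.setT) => [|S].
  by apply: eq_bigl => i; rewrite inE.
apply/eqP/eqP => [h|->]; last by rewrite cardsT card_ord.
by apply/eqP; rewrite finset.eqEcard finset.subsetT cardsT card_ord h leqnn.
Qed.

Variables (m p n : nat).
Hypotheses (pm : (p %| m)%N) (n2 : (2 <= n)%N).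

(** The scalar counterpart of [raised_tuple]; the default 1 matches the identity in [entry]. *)
Definition raised_point a (w : 'I_n -> R[i]) : 'I_n.+1 -> R[i] := fun j =>
  let e k := oapp w 1 (insub k) in
  if j == 0 :> nat then a ^+ m + e 0
  else if (j < n.-1)%N then a ^+ m * e j.-1 + e j
  else if j == n.-1 :> nat then a ^+ m * e j.-1 + e j ^+ p
  else a ^+ (m %/ p) * e j.-1.

Lemma raised_point_theta a (z : 'I_n -> R[i]) :
  raised_point a (theta m p z) = theta m p (snoc_fun z a).
Proof.
have n0 : (0 < n)%N by apply: ltn_trans n2.
apply/funext => j; rewrite /raised_point.
have thE k : (k.+1 < n)%N ->
    oapp (theta m p z) 1 (insub k) = elem_sym k.+1 (fun i => z i ^+ m).
  by move=> kn; rewrite insubT/= ?(ltnW kn)// => ?; rewrite /theta/= kn.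
have thM : oapp (theta m p z) 1 (insub n.-1) = (\prod_k z k) ^+ (m %/ p).
  by rewrite insubT/= ?prednK// => ?; rewrite /theta/= prednK// ltnn.
have jn := ltn_ord j; rewrite ltnS in jn.
case: eqP => [j0|/eqP j0].
  rewrite thE// /theta j0 ltnS n0 elem_sym_snoc elem_sym0 mulr1 addrC//.
have jS : (j.-1.+1 = j)%N by rewrite prednK// lt0n.
case: ltnP => jn1.
  rewrite !thE ?jS; try lia.
  rewrite /theta ltnS; have -> : (j < n)%N by lia.
  by rewrite elem_sym_snoc addrC.
(* Here the last coordinate of theta enters through its p-th power: as q p = m, this is the product
   of the z_k^m, the top symmetric function that theta does not list. *)
case: eqP => jn2.
  rewrite thE ?jS; try lia.
  rewrite [RHS]/theta; have -> : (j.+1 < n.+1)%N by lia.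
  rewrite elem_sym_snoc jn2 thM -exprM divnK// prednK//.
  by rewrite elem_sym_max prodrXl addrC.
have {}jn2 : (j = n :> nat)%N by lia.
rewrite {1}jn2 thM /theta jn2 ltnS ltnn big_ord_recr/= snoc_fun_max exprMn mulrC.
by congr (_ ^+ _ * _); apply: eq_bigr => i _; rewrite snoc_fun_widen.
Qed.

Lemma torus_snoc a (z : 'I_n -> R[i]) : `|a| = 1 -> torus z -> torus (snoc_fun z a).
Proof. by move=> a1 hz k; rewrite /snoc_fun; case: insubP => [i _ _|_]; [exact: hz|]. Qed.

End ElementarySymmetric.

(** * The raised tuple as polynomials in the given operators *)

Section Raised.
Variables (R : realType) (H : completeNormedModType R[i]).
Variables (m p n : nat) (N N' : 'I_n -> H -> H) (a : R[i]).

Lemma entry_symbol k : symbol_of N N' (entry N k) (fun w => oapp w 1 (insub k)).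
Proof. rewrite /entry; case: insub => [i|] /=; [exact: symbol_gen | exact: symbol_id]. Qed.

Lemma iter_symbol T f k : symbol_of N N' T f ->
  symbol_of N N' (iter k T) (fun w => f w ^+ k).
Proof.
move=> hT; elim: k => [|k ih]; first exact: symbol_id.
rewrite (_ : (fun w => _) = fun w => f w * f w ^+ k); first exact: symbol_comp.
by apply/funext => w; rewrite exprS.
Qed.

Lemma raised_tuple_symbol j : symbol_of N N' (raised_tuple m p a N j)
  (fun w => raised_point m p a w j).
Proof.
rewrite /raised_tuple /raised_point.
case: (j == 0 :> nat).
  apply: symbol_add; last exact: entry_symbol.
  rewrite -[X in fun=> X]mulr1; apply: symbol_scale; exact: symbol_id.
case: (j < n.-1)%N.
  by apply: symbol_add; [apply: symbol_scale|]; exact: entry_symbol.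
case: (j == n.-1 :> nat).
  apply: symbol_add; first by apply: symbol_scale; exact: entry_symbol.
  exact: iter_symbol (entry_symbol _).
by apply: symbol_scale; exact: entry_symbol.
Qed.

End Raised.

Theorem theorem3p3 (R : realType) (H : completeNormedModType R[i])
    (dot : {dot H for Num.conj}) (hdot : inner_product_norm dot)
    (m p : nat) (hm : (1 <= m)%N) (hp : (1 <= p)%N) (hpm : (p %| m)%N)
    (n : nat) (hn : (2 <= n)%N) (N : 'I_n -> H -> H)
    (hN : Theta_unitary dot m p N) (alpha : R[i]) (halpha : `|alpha| = 1) :
  Theta_unitary dot m p (raised_tuple m p alpha N).
Proof.
case: hN => bN cN nN specN.
have {}bN i : bop (N i) by apply/bopP.
have /choice[N' hN'] i : exists S, is_adjoint dot (N i) S /\ N i \o S =1 S \o N i.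
  by have [S aS cS] := nN i; exists S.
have aN i := (hN' i).1.
have NN i j x : N i (N j x) = N j (N i x) := cN i j x.
have NN' i x : N i (N' i x) = N' i (N i x) := (hN' i).2 x.
have sym j := raised_tuple_symbol m p N N' alpha j.
split.
- by move=> j; apply/bopP; apply: (symbol_bop hdot bN aN (sym j)).
- by move=> i j x; exact: (symbol_comm hdot bN aN NN NN' (sym i) (sym j)).
- move=> j; have [S [hS aS]] := symbol_adjoint aN (sym j).
  by exists S => // x; exact: (symbol_comm hdot bN aN NN NN' (sym j) hS).
(* The point lam is the raised point of some w = theta(z) with z in the torus, so it is theta of z
   followed by alpha. *)
move=> lam /(joint_spectrum_symbol hdot bN aN NN NN' sym)[w /specN[z hz <-] hlam].
exists (snoc_fun z alpha); first exact: torus_snoc.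
by rewrite -raised_point_theta//; apply/funext => j; rewrite hlam.
Qed.
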